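(* Suppose that the smooth strong solution curves $(r_D^S,\pm\theta_D^S)$, $D>0$ (defined in the context), are global minimizers of $T$ over $\mathcal{A}_0$, i.e. each of them minimizes $T$ among all curves of $\mathcal{A}_0$ with the same endpoints. Let $\epsilon\in(0,1)$ and $\theta_f\in(0,\pi]$. If $\theta_f/2\ge\theta_c^\epsilon$, then $T$ has a unique minimizer over the family of curves $\{\mathcal{F}_{D,\theta_f}^\epsilon : D>0,\ \theta_D^S(1)/2\ge\theta_c^\epsilon\}$ (defined in the context), and this minimizer intersects the constraint circle $\{|x|=\epsilon\}$ tangentially.
   Context: Admissible curves: for a terminal point $B$, $\mathcal{A}_0=\{\alpha\in AC([0,1];\mathbb{R}^2):\alpha(0)=(1,0),\ \alpha(1)=B,\ |\alpha(s)|\le1\ \forall s\}$ ($AC$ = absolutely continuous). A pair $(r,\theta)$ stands for the curve $\alpha(s)=(r(s)\cos\theta(s),r(s)\sin\theta(s))$. The time of flight (inverse-square gravitational field centered at the origin) is $$T[\alpha]=\int_0^1\frac{|\alpha'(s)|}{\sqrt{|\alpha(s)|^{-1}-1}}\,ds,\qquad\text{i.e. in polar form } T[r,\theta]=\int_0^1\sqrt{\frac{r'(s)^2+r(s)^2\theta'(s)^2}{r(s)^{-1}-1}}\,ds.$$ Strong solution curves: for $D>0$ let $r_c(D)\in(0,1)$ be the unique root in $(0,1)$ of $r^3+2Dr-2D=0$. Define $$r_D^S(s)=\begin{cases}2(r_c(D)-1)s+1, & 0\le s\le \tfrac12,\\ 2(1-r_c(D))(s-1)+1, & \tfrac12<s\le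 1,\end{cases}$$ and, with $f_D(u)=\sqrt{\dfrac{2(1-u)D}{u^5-2u^2D(1-u)}}$ for $u\in(r_c(D),1]$, $$\theta_D^S(s)=\begin{cases}\displaystyle\int_{r_D^S(s)}^1 f_D(u)\,du, & 0\le s\le\tfrac12,\\[2mm] \displaystyle\theta_D^S(1/2)+\int_{r_c(D)}^{r_D^S(s)}f_D(u)\,du, & \tfrac12\le s\le1.\end{cases}$$ Critical parameter and angle: $D(\epsilon)>0$ is the unique value of $D$ for which the strong solution curve touches the circle of radius $\epsilon$ tangentially, i.e. $r_c(D(\epsilon))=\epsilon$, and $\theta_c^\epsilon=\theta_{D(\epsilon)}^S(1/2)$ is the angle of the tangency point. The family: for $D>0$ with $\theta_D^S(1)/2\ge\theta_c^\epsilon$, let $s_D^\epsilon=\min\{s\in[0,1]: r_D^S(s)=\epsilon\}$ be the first parameter at which the strong solution meets the circle of radius $\epsilon$. The curve $\mathcal{F}_{D,\theta_f}^\epsilon$ follows the strong solution until it meets the circle, rides along the circle, and then leaves along a rotated copy of the last part of the same strong solution, ending at polar coordinates $(1,\theta_f)$: $$\mathcal{F}_{D,\theta_f}^\epsilon(s)=\begin{cases}\big(r_D^S(h(s))\cos\theta_D^S(h(s)),\ r_D^S(h(s))\sin\theta_D^S(h(s))\big), & s\in[0,1/3),\\ (\epsilon\cos t(s),\ \epsilon\sin t(s)), & s\in[1/3,2/3],\\ \big(r_D^S(j(s))\cos l(s),\ r_D^S(j(s))\sin l(s)\big), & s\in(2/3,1],\end{cases}$$ where $h(s)=3s_D^\epsilon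 s$, $j(s)=3s_D^\epsilon s+1-3s_D^\epsilon$, $l(s)=\theta_D^S(j(s))+\theta_f-\theta_D^S(1)$, and $t(s)=3(\theta_f-2\theta_D^S(s_D^\epsilon))s+3\theta_D^S(s_D^\epsilon)-\theta_f$. ''Intersects the constraint tangentially'' means that at the points where the strong-solution arcs join the circular arc, the tangent line of the strong-solution arc coincides with the tangent line of the circle. *)

(* Defs.v *)
From HB Require Import structures.
From mathcomp Require Import all_boot all_order all_algebra.
From mathcomp Require Import all_classical all_reals all_analysis.

Set Implicit Arguments.
Unset Strict Implicit.
Unset Printing Implicit Defensive.

Import Order.TTheory GRing.Theory Num.Theory.
Import numFieldNormedType.Exports.

Local Open Scope classical_set_scope.
Local Open Scope ring_scope.

Section brachistochrone.
Context {R : realType}.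
Implicit Types (D e tf r t s : R) (a g : R -> R * R).

(* The library norm on [R * R] is the sup norm; the Euclidean one is needed. *)
Definition dotp (p q : R * R) : R := p.1 * q.1 + p.2 * q.2.
Definition enorm (p : R * R) : R := Num.sqrt (dotp p p).

Definition polar r t : R * R := (r * cos t, r * sin t).

Definition abs_continuous01 a : Prop :=
  forall eta, 0 < eta -> exists2 delta, 0 < delta &
    forall n (I : 'I_n -> R * R),
      (forall k, 0 <= (I k).1 /\ (I k).1 <= (I k).2 /\ (I k).2 <= 1) ->
      trivIset setT (fun k => `](I k).1, (I k).2[%classic) ->
      \sum_(k < n) ((I k).2 - (I k).1) < delta ->
      \sum_(k < n) enorm (a (I k).2 - a (I k).1) < eta.

Definition A0 (B : R * R) : set (R -> R * R) :=
  [set a | [/\ abs_continuous01 a, a 0 = (1, 0), a 1 = B &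
               forall s, 0 <= s <= 1 -> enorm (a s) <= 1]].

(* Meaningful wherever [a] is differentiable, i.e. almost everywhere on [0, 1]
   for absolutely continuous [a]. *)
Definition velocity a s : R * R :=
  (derive1 (fun x => (a x).1) s, derive1 (fun x => (a x).2) s).

(* Extended-real arithmetic: [0^-1 = +oo] and [0 * +oo = 0], so the weight
   [(|a|^-1 - 1)^(-1/2)] is [0] at the origin and [+oo] on the unit circle
   (whereas real division by zero would make motion on the unit circle free),
   and a curve at rest costs nothing. *)
Definition flight_time a : \bar R :=
  (\int[lebesgue_measure]_(s in `[0%R, 1%R])
    ((enorm (velocity a s))%:E / sqrte ((enorm (a s))%:E^-1 - 1)))%E.

Definition is_minimizer (F : set (R -> R * R)) a : Prop :=
  F a /\ forall b, F b -> (flight_time a <= flight_time b)%E.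

Definition r_c D : R :=
  get [set r | 0 < r < 1 /\ r ^+ 3 + 2 * D * r - 2 * D = 0].

Definition rS D s : R :=
  if s <= 1 / 2 then 2 * (r_c D - 1) * s + 1
  else 2 * (1 - r_c D) * (s - 1) + 1.

Definition fS D (u : R) : R :=
  Num.sqrt ((2 * (1 - u) * D) / (u ^+ 5 - 2 * u ^+ 2 * D * (1 - u))).

Definition thetaS_half D : R :=
  \int[lebesgue_measure]_(u in `[rS D (1 / 2), 1]) fS D u.

Definition thetaS D s : R :=
  if s <= 1 / 2 then \int[lebesgue_measure]_(u in `[rS D s, 1]) fS D u
  else thetaS_half D + \int[lebesgue_measure]_(u in `[r_c D, rS D s]) fS D u.

Definition strong_curve D s : R * R := polar (rS D s) (thetaS D s).
Definition strong_curve_opp D s : R * R := polar (rS D s) (- thetaS D s).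

Definition D_crit e : R := get [set D | 0 < D /\ r_c D = e].
Definition theta_crit e : R := thetaS (D_crit e) (1 / 2).

Definition s_hit e D : R :=
  get [set s | (0 <= s <= 1 /\ rS D s = e) /\
               forall s', 0 <= s' <= 1 -> rS D s' = e -> s <= s'].

Definition family_curve e tf D s : R * R :=
  let sD := s_hit e D in
  let h := 3 * sD * s in
  let j := 3 * sD * s + 1 - 3 * sD in
  let l := thetaS D j + tf - thetaS D 1 in
  let t := 3 * (tf - 2 * thetaS D sD) * s + 3 * thetaS D sD - tf in
  if s < 1 / 3 then polar (rS D h) (thetaS D h)
  else if s <= 2 / 3 then polar e t
  else polar (rS D j) l.

Definition curve_family e tf : set (R -> R * R) :=
  [set a | exists D, [/\ 0 < D, theta_crit e <= thetaS D 1 / 2 &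
                         a = family_curve e tf D]].

(* [L] is the limit, as [s] tends to [s0] along [F], of the secant lines through
   [g s0] and [g s]: the angle between the secant and the direction [v] of [L]
   tends to [0] modulo [pi].  No derivative is used, because the arcs are
   parametrized so that their velocity is unbounded at a tangency point. *)
Definition is_tangent_line g (F : set_system R) s0 (L : set (R * R)) : Prop :=
  exists v : R * R,
    [/\ enorm v = 1,
        L = range (fun x : R => g s0 + (x * v.1, x * v.2)) &
        `|dotp (g s - g s0) v| / enorm (g s - g s0) @[s --> F] --> (1 : R)].

Definition circle e t : R * R := polar e t.

Definition tangent_to_circle_at e g (F : set_system R) s0 : Prop :=
  exists t0, circle e t0 = g s0 /\
    exists L, is_tangent_line g F s0 L /\
              is_tangent_line (circle e) t0^' t0 L.

(* On curves of [curve_family e tf] the strong-solution arcs are run on [[0, 1/3)] and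
   [(2/3, 1]], hence the one-sided filters. *)
Definition meets_circle_tangentially e a : Prop :=
  tangent_to_circle_at e a (1 / 3)^'- (1 / 3) /\
  tangent_to_circle_at e a (2 / 3)^'+ (2 / 3).

End brachistochrone.

(* Main.v *)
Require Import Defs.
From mathcomp Require Import all_boot all_order all_algebra.
From mathcomp Require Import all_classical all_reals all_analysis.
From mathcomp Require Import measurable_realfun ring lra.

Set Implicit Arguments.
Unset Strict Implicit.
Unset Printing Implicit Defensive.

Import Order.TTheory GRing.Theory Num.Theory.
Import numFieldNormedType.Exports.

Local Open Scope classical_set_scope.
Local Open Scope ring_scope.

(** Parametrize a strong solution by its radius u, and let tilt D u be the sine
    of the angle between the curve and the radius through the point.  With
    slowness u the reciprocal of the speed at radius u, Snell's law holds:
    u * slowness u * tilt D u is the constant sqrt (2 D), and the curve turns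
    back where the tilt reaches 1, which is at u = r_c D.  Along the curve the
    polar angle changes by fS D u = tilt / (u * sqrt (1 - tilt^2)) and the clock
    by radial_cost D u = slowness u / sqrt (1 - tilt^2) per unit of radius.

    Let D' be the critical parameter, so that r_c D' = e, and let D <= D'.  The
    curve of the family with parameter D crosses the radii between 1 and e
    twice and turns along the circle by the remaining angle, which costs
    k = e * slowness e per radian.  Its flight time is therefore
      2 * \int_e^1 radial_cost D + k * `|tf - 2 * \int_e^1 fS D|
        >= k * tf + 2 * \int_e^1 (radial_cost D - k * fS D),
    with equality for D = D' because the angle along the circle is nonnegative
    there.  Write x and y for the tilts of D and D' at radius u.  Snell's law
    gives k = slowness u * u * y, so that
      radial_cost D u - k * fS D u = slowness u * (1 - x y) / sqrt (1 - x^2),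
    which exceeds its value slowness u * sqrt (1 - y^2) at D = D' as soon as
    x < y: this is the inequality cos (alpha - beta) < 1 (cos_sub_lt1, cost_lt).
    Integrating this pointwise comparison makes D' the strict minimizer among
    the parameters D <= D' (arc_cost_lt, flight_time_lt).

    The condition that defines the family says exactly that D <= D', because
    the half angle swept by the strong solution decreases with D
    (sweep_r_c_lt).  To see this, integrate fS D by parts: it is the derivative
    of 2 (1 - u) / (3 - 2 u) * acos (tilt D u), which vanishes at both ends of
    the interval [r_c D, 1], plus 2 / (3 - 2 u)^2 * acos (tilt D u), and both
    this last function and its domain decrease as D grows.

    The minimizer is tangent to the circle because fS D' is infinite at
    radius e: near the junction the radius varies infinitely more slowly than
    the polar angle (sweep_vertical), so the secants turn towards the circle
    (tangent_line_polar). *)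

(** * Improper integrals on open intervals *)

Section calculus.
Context {R : realType}.
Implicit Types (a b x : R) (f g F : R -> R).
Notation mu := (@lebesgue_measure R).

Lemma oo_continuous_measurable f a b :
  {in `]a, b[, continuous f} -> measurable_fun `]a, b[ f.
Proof.
move=> cf; apply: open_continuous_measurable_fun.
  exact: interval_open.
by move=> x; rewrite inE/= => /cf.
Qed.

Lemma oo_continuous_emeasurable f a b :
  {in `]a, b[, continuous f} -> measurable_fun `]a, b[ (fun x => (f x)%:E).
Proof. by move=> /oo_continuous_measurable mf; apply/measurable_EFinP. Qed.

(** The fundamental theorem of calculus for an integrand that may be infinite at
    both ends: exhaust the open interval by compact ones and use monotone
    convergence, which is where the sign of [f] enters. *)
Lemma integral_derive_oo F f a b : a < b ->
  {within `[a, b], continuous F} ->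
  (forall x, x \in `]a, b[ -> is_derive x 1 F (f x)) ->
  {in `]a, b[, continuous f} ->
  (forall x, x \in `]a, b[ -> 0 <= f x) ->
  (\int[mu]_(x in `[a, b]) (f x)%:E = (F b - F a)%:E)%E.
Proof.
move=> ab cF dF cf f0.
have [cFoo cFa cFb] := (continuous_within_itvP F ab).1 cF.
(* The factor 1 / 3 makes all the intervals [a + e n, b - e n] nondegenerate. *)
pose e n : R := (b - a) / 3 * n.+1%:R^-1.
have e0 n : 0 < e n.
  by rewrite mulr_gt0 ?invr_gt0// ?ltr0n// divr_gt0 ?subr_gt0// ltr0n.
have e3 n : e n <= (b - a) / 3.
  apply: ler_piMr; first by rewrite divr_ge0// subr_ge0 ltW.
  by rewrite invf_le1 ?ltr0n// ler1n.
have elim : e n @[n --> \oo] --> 0.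
  rewrite -[X in _ --> X](mulr0 ((b - a) / 3)).
  by apply: cvgM; [exact: cvg_cst|exact: cvg_harmonic].
have edecr : {homo e : n m / (n <= m)%N >-> m <= n}.
  move=> n m nm; rewrite /e ler_pM2l ?divr_gt0 ?subr_gt0//.
  by rewrite lef_pV2 ?posrE ?ltr0n// ler_nat ltnS.
pose E n := [set` `[a + e n, b - e n]].
have Eab n : E n `<=` `]a, b[.
  move=> x; rewrite /E/= !in_itv/=.
  by move: (e0 n) => en /andP[]; lra.
have UE : \bigcup_n E n = `]a, b[%classic.
  apply/seteqP; split=> [x [n _ /Eab]//|x/=].
  rewrite in_itv/= => /andP[ax xb].
  have /cvgrPdist_lt /(_ (Num.min (x - a) (b - x))) := elim.
  rewrite lt_min !subr_gt0 ax xb => /(_ isT)[n _ /(_ n (leqnn n))].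
  rewrite sub0r normrN gtr0_norm// lt_min => /andP[enl enr].
  by exists n => //; rewrite /E/= in_itv/=; lra.
have Eint n : (\int[mu]_(x in E n) (f x)%:E = (F (b - e n) - F (a + e n))%:E)%E.
  have ltab : a + e n < b - e n by move: (e3 n) (e0 n); lra.
  have sub : {subset `[a + e n, b - e n] <= `]a, b[}.
    by move=> x xE; exact: (Eab n).
  have sub' : {subset `]a + e n, b - e n[ <= `]a, b[}.
    by move=> x /subset_itv_oo_cc/sub.
  rewrite EFinB; apply: continuous_FTC2 => //.
  - by apply: continuous_in_subspaceT => x; rewrite inE/= => /sub/cf.
  - apply: (derivable_oo_continuousW ltab _ (_ : derivable_oo_LRcontinuous F a b)).
      by move=> x /Eab/subset_itv_oo_cc.
    by split=> // x /dF.
  - by move=> x /sub'/dF; rewrite derive1E => /@derive_val.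
have mf : measurable_fun `]a, b[ f by exact: oo_continuous_measurable.
rewrite (@integral_itv_bndoo _ _ _ (EFin \o f)); last exact/measurable_EFinP.
have : (\int[mu]_(x in E n) (f x)%:E @[n --> \oo] -->
    \int[mu]_(x in \bigcup_n E n) (f x)%:E)%E.
  apply: ge0_nondecreasing_set_cvg_integral => //.
  - apply/nondecreasing_seqP => n; apply/subsetPset => x; rewrite /E/= !in_itv/=.
    by move: (edecr _ _ (leqnSn n)); lra.
  - by move=> n; exact: measurable_itv.
  - move=> n; apply/measurable_EFinP; apply: measurable_funS mf => //.
  - by move=> n x /Eab/f0; rewrite lee_fin.
rewrite UE => /cvg_lim <- //; apply/cvg_lim => //.
under eq_fun do rewrite Eint.
apply: cvg_EFin; first exact: nearW.
apply: cvgB.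
  apply: (cvg_at_leftP F b (F b)).1 => //; split=> [n|].
    by move: (e0 n); lra.
  by rewrite -[X in _ --> X]subr0; apply: cvgB => //; exact: cvg_cst.
apply: (cvg_at_rightP F a (F a)).1 => //; split=> [n|].
  by move: (e0 n); lra.
by rewrite -[X in _ --> X]addr0; apply: cvgD => //; exact: cvg_cst.
Qed.

Lemma ge0_integral_oo_split (g : R -> \bar R) a b c : a < b -> b < c ->
  measurable_fun `]a, b[ g -> measurable_fun `]b, c[ g ->
  (forall x, (0 <= g x)%E) ->
  measurable_fun `]a, c[ g /\
  (\int[mu]_(x in `]a, c[) g x =
   \int[mu]_(x in `]a, b[) g x + \int[mu]_(x in `]b, c[) g x)%E.
Proof.
move=> ab bc mab mbc g0.
have mabc : measurable_fun `]a, b] g by exact/emeasurable_fun_itv_bndo_bndcP.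
have U : `]a, c[%classic = `]a, b] `|` `]b, c[ :> set R.
  by rewrite -itv_bndbnd_setU// bnd_simp// ltW.
have mU : measurable_fun (`]a, b] `|` `]b, c[) g.
  by apply/measurable_funU.
rewrite U; split=> //; rewrite ge0_integral_setU//.
  by rewrite integral_itv_bndoo.
apply/disj_set2P; rewrite -subset0 => x/=; rewrite !in_itv/= => -[/andP[_ xb]].
by rewrite ltNge xb.
Qed.

(** A function that is positive on a set of positive measure has a positive
    integral; finiteness on the left allows the subtraction. *)
Lemma lt_integral_oo f g a b : a < b ->
  {in `]a, b[, continuous f} -> {in `]a, b[, continuous g} ->
  (forall x, x \in `]a, b[ -> 0 <= f x < g x) ->
  (\int[mu]_(x in `]a, b[) (f x)%:E < +oo)%E ->
  (\int[mu]_(x in `]a, b[) (f x)%:E < \int[mu]_(x in `]a, b[) (g x)%:E)%E.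
Proof.
move=> ab cf cg fg foo.
have ch : {in `]a, b[, continuous (fun x => g x - f x)}.
  by move=> x xab; apply: cvgB; [exact: cg|exact: cf].
have mh : measurable_fun `]a, b[ (fun x => (g x - f x)%:E).
  exact: oo_continuous_emeasurable.
have h0 x : x \in `]a, b[ -> 0 < g x - f x by move=> /fg/andP[_]; rewrite subr_gt0.
have -> : (\int[mu]_(x in `]a, b[) (g x)%:E =
    \int[mu]_(x in `]a, b[) (f x)%:E + \int[mu]_(x in `]a, b[) (g x - f x)%:E)%E.
  rewrite -ge0_integralD//.
  - by apply: eq_integral => x _; rewrite -EFinD addrC subrK.
  - by move=> x /fg/andP[]; rewrite lee_fin.
  - exact: oo_continuous_emeasurable.
  - by move=> x /h0/ltW; rewrite lee_fin.
have f0 : (0 <= \int[mu]_(x in `]a, b[) (f x)%:E)%E.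
  by apply: integral_ge0 => x /fg/andP[]; rewrite lee_fin.
rewrite lteDl ?ge0_fin_numE// lt0e; apply/andP; split; last first.
  by apply: integral_ge0 => x /h0/ltW; rewrite lee_fin.
apply/eqP => hz.
have : (\int[mu]_(x in `]a, b[) `|(g x - f x)%:E| = 0)%E.
  rewrite -hz; apply: eq_integral => x; rewrite inE => /h0/ltW hx.
  by rewrite gee0_abs// lee_fin.
move=> /(ae_eq_integral_abs mu (measurable_itv _) mh) [N [mN N0 sub]].
have : (mu `]a, b[ <= mu N)%E.
  apply: le_measure; rewrite ?inE//.
  move=> x xab; apply: sub => /= /(_ xab) [hx0].
  by have := h0 _ xab; rewrite hx0 ltxx.
rewrite N0 lebesgue_measure_itv/= lte_fin ab -EFinB lee_fin.
by rewrite leNgt subr_gt0 ab.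
Qed.

Lemma ge0_le_integral_oo_fin f g a b :
  {in `]a, b[, continuous f} -> {in `]a, b[, continuous g} ->
  (forall x, x \in `]a, b[ -> 0 <= f x <= g x) ->
  (\int[mu]_(x in `]a, b[) (g x)%:E < +oo)%E ->
  (\int[mu]_(x in `]a, b[) (f x)%:E < +oo)%E.
Proof.
move=> cf cg fg; apply: le_lt_trans; apply: ge0_le_integral => //.
- by move=> x /fg/andP[]; rewrite lee_fin.
- exact: oo_continuous_emeasurable.
- exact: oo_continuous_emeasurable.
- by move=> x /fg/andP[? ?]; rewrite lee_fin.
Qed.

End calculus.

(** * Strong solutions as functions of the radius *)

Section strong.
Context {R : realType}.
Implicit Types (D u e : R).

Lemma cubic_root_unique D r r' : 0 < D -> 0 < r -> 0 < r' ->
  r ^+ 3 + 2 * D * r - 2 * D = 0 -> r' ^+ 3 + 2 * D * r' - 2 * D = 0 -> r = r'.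
Proof.
move=> D0 r0 r'0 Er Er'.
have : (r - r') * (r ^+ 2 + r * r' + r' ^+ 2 + 2 * D) = 0.
  by transitivity (r ^+ 3 + 2 * D * r - 2 * D - (r' ^+ 3 + 2 * D * r' - 2 * D));
    [ring|rewrite Er Er' subrr].
move=> /eqP; rewrite mulf_eq0 => /orP[|/eqP h].
  by rewrite subr_eq0 => /eqP.
have := mulr_gt0 r0 r'0; have := sqr_ge0 r; have := sqr_ge0 r'; lra.
Qed.

Lemma r_cP D : 0 < D ->
  0 < r_c D < 1 /\ r_c D ^+ 3 + 2 * D * r_c D - 2 * D = 0.
Proof.
move=> D0; rewrite /r_c; apply: (@getPex _ [set r | 0 < r < 1 /\
  r ^+ 3 + 2 * D * r - 2 * D = 0]).
pose p r := r ^+ 3 + 2 * D * r - 2 * D.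
have [||r + pr] := @IVT R p 0 1 0 ler01.
- apply: continuous_subspaceT => x; rewrite /p.
  apply: cvgB; last exact: cvg_cst.
  apply: cvgD; first exact: exprn_continuous.
  by apply: cvgM; [exact: cvg_cst|exact: cvg_id].
- have -> : p 0 = - (2 * D) by rewrite /p; ring.
  have -> : p 1 = 1 by rewrite /p; ring.
  by rewrite ge_min le_max; apply/andP; split; apply/orP; [left|right]; lra.
rewrite in_itv/= => /andP[r0 r1]; exists r; split => //.
apply/andP; split; rewrite lt_neqAle ?r0 ?r1 andbT; apply/eqP => rE.
  by move: pr; rewrite /p -rE; lra.
by move: pr; rewrite /p rE; lra.
Qed.

Lemma r_c_gt0 D : 0 < D -> 0 < r_c D. Proof. by move=> /r_cP[/andP[]]. Qed.
Lemma r_c_lt1 D : 0 < D -> r_c D < 1. Proof. by move=> /r_cP[/andP[]]. Qed.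

Lemma r_cE D : 0 < D -> r_c D ^+ 3 = 2 * D * (1 - r_c D).
Proof. by move=> /r_cP[_]; lra. Qed.

Lemma r_c_unique D r : 0 < D -> 0 < r -> r ^+ 3 = 2 * D * (1 - r) -> r_c D = r.
Proof.
move=> D0 r0 rE; have [/andP[c0 _] cE] := r_cP D0.
by apply: cubic_root_unique cE _ => //; rewrite rE; ring.
Qed.

Lemma r_c_lt D D' : 0 < D -> D < D' -> r_c D < r_c D'.
Proof.
move=> D0 DD'; have D'0 : 0 < D' by exact: lt_trans DD'.
rewrite ltNge; apply/negP => cc.
have : r_c D' ^+ 3 <= r_c D ^+ 3.
  by rewrite lerXn2r// nnegrE ltW// r_c_gt0.
rewrite !r_cE//; apply/negP; rewrite -ltNge.
apply: (@le_lt_trans _ _ (2 * D * (1 - r_c D'))).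
  by rewrite ler_pM2l ?mulr_gt0//; lra.
by rewrite ltr_pM2r ?subr_gt0 ?r_c_lt1// ltr_pM2l.
Qed.

Lemma D_crit_spec e : 0 < e < 1 -> 0 < D_crit e /\ r_c (D_crit e) = e.
Proof.
move=> /andP[e0 e1]; rewrite /D_crit.
apply: (@getPex _ [set D | 0 < D /\ r_c D = e]).
have e1' : 0 < 1 - e by rewrite subr_gt0.
exists (e ^+ 3 / (2 * (1 - e))).
have D0 : 0 < e ^+ 3 / (2 * (1 - e)) by rewrite divr_gt0 ?exprn_gt0 ?mulr_gt0.
split=> //; apply: r_c_unique => //; field.
by rewrite gt_eqF.
Qed.

(** The sine of the angle between the strong solution and the radius, at
    radius [u]. *)
Definition tilt D u : R := Num.sqrt (2 * D * (1 - u) / u ^+ 3).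

Lemma tilt_ge0 D u : 0 <= tilt D u. Proof. exact: sqrtr_ge0. Qed.

Lemma sqr_tilt D u : 0 < D -> 0 < u <= 1 -> tilt D u ^+ 2 = 2 * D * (1 - u) / u ^+ 3.
Proof.
move=> D0 /andP[u0 u1]; rewrite sqr_sqrtr// divr_ge0 ?exprn_ge0 ?mulr_ge0 ?subr_ge0//;
  exact: ltW.
Qed.

Lemma tilt_gt0 D u : 0 < D -> 0 < u < 1 -> 0 < tilt D u.
Proof.
move=> D0 /andP[u0 u1].
by rewrite sqrtr_gt0 divr_gt0 ?exprn_gt0 ?mulr_gt0 ?subr_gt0.
Qed.

Lemma tilt_lt D D' u : 0 < D -> D < D' -> 0 < u < 1 -> tilt D u < tilt D' u.
Proof.
move=> D0 DD' /andP[u0 u1].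
rewrite ltr_sqrt; last first.
  by rewrite divr_gt0 ?exprn_gt0 ?mulr_gt0 ?subr_gt0// (lt_trans D0).
by rewrite ltr_pM2r ?invr_gt0 ?exprn_gt0// ltr_pM2r ?subr_gt0// ltr_pM2l.
Qed.

Lemma cubic_gt D u : 0 < D -> r_c D < u -> 2 * D * (1 - u) < u ^+ 3.
Proof.
move=> D0 cu; have c0 := r_c_gt0 D0.
apply: (@lt_trans _ _ (r_c D ^+ 3)).
  by rewrite r_cE// ltr_pM2l ?mulr_gt0//; lra.
by rewrite ltrXn2r// ?nnegrE ltW// (lt_trans c0).
Qed.

Lemma tilt_lt1 D u : 0 < D -> r_c D < u <= 1 -> tilt D u < 1.
Proof.
move=> D0 /andP[cu u1]; have u0 : 0 < u by rewrite (lt_trans _ cu)// r_c_gt0.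
rewrite -sqrtr1 ltr_sqrt// ltr_pdivrMr ?exprn_gt0// mul1r.
exact: cubic_gt.
Qed.

Lemma tilt_r_c D : 0 < D -> tilt D (r_c D) = 1.
Proof.
by move=> D0; rewrite /tilt -r_cE// divff ?sqrtr1// expf_neq0// gt_eqF// r_c_gt0.
Qed.

Lemma subr_sqr_tilt_gt0 D u : 0 < D -> r_c D < u <= 1 -> 0 < 1 - tilt D u ^+ 2.
Proof.
move=> D0 cu; rewrite subr_gt0 -(expr1n _ 2) ltrXn2r// ?nnegrE ?tilt_ge0//.
exact: tilt_lt1.
Qed.

Lemma fS_ge0 D u : 0 <= fS D u. Proof. exact: sqrtr_ge0. Qed.

(** The angular rate is the tangent of the tilt angle, divided by the radius. *)
Lemma fS_tilt D u : 0 < D -> r_c D < u <= 1 ->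
  fS D u = tilt D u / (u * Num.sqrt (1 - tilt D u ^+ 2)).
Proof.
move=> D0 cu; have /andP[cu' u1] := cu.
have u0 : 0 < u by rewrite (lt_trans _ cu')// r_c_gt0.
have t1 := subr_sqr_tilt_gt0 D0 cu.
apply/eqP; rewrite -(@eqrXn2 _ 2)//; last 2 first.
  exact: sqrtr_ge0.
  by rewrite divr_ge0 ?tilt_ge0// mulr_ge0 ?sqrtr_ge0 ?ltW.
have c := cubic_gt D0 cu'.
rewrite expr_div_n exprMn (sqr_sqrtr (ltW t1)) !sqr_tilt ?u0//.
have den : u ^+ 5 - 2 * u ^+ 2 * D * (1 - u) = u ^+ 2 * (u ^+ 3 - 2 * D * (1 - u)) by ring.
rewrite sqr_sqrtr; last first.
  rewrite den divr_ge0// ?mulr_ge0 ?exprn_ge0 ?subr_ge0// ltW//.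
apply/eqP; rewrite den; field.
by rewrite !gt_eqF//= ?subr_gt0.
Qed.

Lemma fS_gt0 D u : 0 < D -> r_c D < u < 1 -> 0 < fS D u.
Proof.
move=> D0 /andP[cu u1]; have u0 : 0 < u by rewrite (lt_trans _ cu)// r_c_gt0.
rewrite fS_tilt ?cu ?ltW//; rewrite divr_gt0 ?tilt_gt0 ?u0// mulr_gt0// sqrtr_gt0.
by rewrite subr_sqr_tilt_gt0 ?cu ?ltW.
Qed.

Lemma tilt_continuous D u : 0 < u -> {for u, continuous (tilt D)}.
Proof.
move=> u0; apply: (@continuous_comp _ _ _ (fun u => 2 * D * (1 - u) / u ^+ 3) Num.sqrt).
  apply: cvgM; last by apply: cvgV; [rewrite expf_neq0// gt_eqF|exact: exprn_continuous].
  by apply: cvgM; [exact: cvg_cst|apply: cvgB; [exact: cvg_cst|exact: cvg_id]].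
exact: sqrt_continuous.
Qed.

Lemma is_derive_tilt D u : 0 < D -> 0 < u < 1 ->
  is_derive u 1 (tilt D) (- (tilt D u * (3 - 2 * u) / (2 * u * (1 - u)))).
Proof.
move=> D0 u01; have /andP[u0 u1] := u01.
have q0 : 0 < 2 * D * (1 - u) / u ^+ 3.
  by rewrite divr_gt0 ?exprn_gt0 ?mulr_gt0 ?subr_gt0.
have dq : is_derive u 1 (fun u => 2 * D * (1 - u) / u ^+ 3)
    (- (2 * D * (3 - 2 * u) / u ^+ 4)).
  have u3 : u ^+ 3 != 0 by rewrite expf_neq0// gt_eqF.
  have d1 : is_derive u 1 (fun u => 2 * D * (1 - u)) (- (2 * D)).
    by apply: is_derive_eq; rewrite /GRing.scale/=; ring.
  have d2 : is_derive u 1 (fun u : R => u ^+ 3) (3 * u ^+ 2).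
    by apply: is_derive_eq; rewrite /GRing.scale/=; ring.
  have d3 := @is_deriveV R (fun u => u ^+ 3) u _ _ u3 d2.
  apply: (is_derive_eq (is_deriveM d1 d3)); rewrite /GRing.scale/=; field.
  by rewrite gt_eqF.
have := @is_derive1_comp R Num.sqrt (fun u => 2 * D * (1 - u) / u ^+ 3) u _ _
  (is_derive1_sqrt q0) dq.
move=> /is_derive_eq; apply.
have t0 := tilt_gt0 D0 u01.
have tE := sqr_tilt D0 (_ : 0 < u <= 1).
rewrite -/(tilt D u).
apply: (@mulfI _ (tilt D u)); first by rewrite gt_eqF.
transitivity (- (D * (3 - 2 * u) / u ^+ 4)); first by field; rewrite !gt_eqF.
transitivity (- (tilt D u ^+ 2 * (3 - 2 * u) / (2 * u * (1 - u)))).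
  rewrite tE ?u0 ?ltW//; field.
  by rewrite !gt_eqF// subr_gt0.
by field; rewrite !gt_eqF// subr_gt0.
Qed.
End strong.

(** * The polar angle swept by a strong solution *)

Section sweep.
Context {R : realType}.
Implicit Types (D u e : R).
Notation mu := (@lebesgue_measure R).

(** The polar angle between radius [u] and radius 1.  Both halves of the strong
    solution are expressed with this one function of the radius. *)
Definition sweep D u : R := \int[mu]_(v in `[u, 1]) fS D v.

Lemma fS_continuous D u : 0 < D -> r_c D < u -> {for u, continuous (fS D)}.
Proof.
move=> D0 cu; have u0 : 0 < u by rewrite (lt_trans _ cu)// r_c_gt0.
apply: (@continuous_comp _ _ _ (fun u => 2 * (1 - u) * D /
  (u ^+ 5 - 2 * u ^+ 2 * D * (1 - u))) Num.sqrt); last exact: sqrt_continuous.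
have c1 : {for u, continuous (fun u => 1 - u)}.
  by apply: cvgB; [exact: cvg_cst|exact: cvg_id].
have c2 : {for u, continuous (fun u => 2 * u ^+ 2 * D * (1 - u))}.
  apply: cvgM c1; apply: cvgM; last exact: cvg_cst.
  by apply: cvgM; [exact: cvg_cst|exact: exprn_continuous].
apply: cvgM.
  by apply: cvgM; [apply: cvgM => //; exact: cvg_cst|exact: cvg_cst].
apply: cvgV; last by apply: cvgB => //; exact: exprn_continuous.
have -> : u ^+ 5 - 2 * u ^+ 2 * D * (1 - u) = u ^+ 2 * (u ^+ 3 - 2 * D * (1 - u)).
  by ring.
by rewrite mulf_neq0 ?expf_neq0 ?gt_eqF ?subr_gt0 ?cubic_gt.
Qed.

Lemma fS_oo_continuous D u : 0 < D -> r_c D <= u -> {in `]u, 1[, continuous (fS D)}.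
Proof.
move=> D0 cu v; rewrite in_itv/= => /andP[uv _].
by apply: fS_continuous => //; exact: le_lt_trans uv.
Qed.

(** The singularity at the turning radius is of inverse square root type, since
    [u ^+ 3 - 2 * D * (1 - u)] vanishes there with a positive slope; this
    makes [fS D] integrable. *)
Lemma fS_le D u : 0 < D -> r_c D < u < 1 ->
  fS D u <= (r_c D)^-1 * (Num.sqrt (u - r_c D))^-1.
Proof.
move=> D0 /andP[cu u1]; have c0 := r_c_gt0 D0.
have u0 : 0 < u by rewrite (lt_trans _ cu).
have uc : 0 < u - r_c D by rewrite subr_gt0.
rewrite -(@ler_pXn2r _ 2)//; last 2 first.
  by rewrite nnegrE fS_ge0.
  by rewrite nnegrE mulr_ge0// invr_ge0 ?sqrtr_ge0 ltW.
rewrite exprMn !exprVn (sqr_sqrtr (ltW uc)).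
have den : u ^+ 5 - 2 * u ^+ 2 * D * (1 - u) = u ^+ 2 * (u ^+ 3 - 2 * D * (1 - u)).
  by ring.
have g := cubic_gt D0 cu.
have Ecu : 2 * D * (u - r_c D) <= u ^+ 3 - 2 * D * (1 - u).
  have : r_c D ^+ 3 <= u ^+ 3 by rewrite lerXn2r// ?nnegrE ltW.
  by rewrite r_cE//; lra.
rewrite /fS den sqr_sqrtr; last first.
  rewrite divr_ge0// ?mulr_ge0 ?subr_ge0 ?exprn_ge0// ltW//.
rewrite ler_pdivrMr ?mulr_gt0 ?exprn_gt0 ?subr_gt0//.
rewrite -invfM [leRHS]mulrC ler_pdivlMr ?mulr_gt0 ?exprn_gt0//.
have c2u2 : r_c D ^+ 2 <= u ^+ 2 by rewrite lerXn2r// ?nnegrE ltW.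
apply: (@le_trans _ _ (r_c D ^+ 2 * (2 * D * (u - r_c D)))).
  have : 0 <= r_c D ^+ 2 * (2 * D * (u - r_c D)) * u.
    by rewrite !mulr_ge0// ltW.
  by lra.
apply: ler_pM => //; first by rewrite exprn_ge0// ltW.
by rewrite !mulr_ge0// ltW.
Qed.

Lemma integral_invsqrt (c : R) : c < 1 ->
  (\int[mu]_(x in `]c, 1%R[) ((Num.sqrt (x - c))^-1)%:E < +oo)%E.
Proof.
move=> c1.
have ci : {in `]c, 1%R[, continuous (fun x : R => (Num.sqrt (x - c))^-1)}.
  move=> x; rewrite in_itv/= => /andP[cx _]; apply: cvgV.
    by rewrite gt_eqF// sqrtr_gt0 subr_gt0.
  apply: (@continuous_comp _ _ _ (fun x => x - c) Num.sqrt); last exact: sqrt_continuous.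
  by apply: cvgB; [exact: cvg_id|exact: cvg_cst].
rewrite -(@integral_itv_bndoo _ _ _ _ true false); last exact: oo_continuous_emeasurable.
pose F x := 2 * Num.sqrt (x - c).
have -> : (\int[mu]_(x in `[c, 1%R]) ((Num.sqrt (x - c))^-1)%:E = (F 1 - F c)%:E)%E; last exact: ltry.
apply: (@integral_derive_oo R F) => //.
- apply: continuous_subspaceT => x; apply: cvgM; first exact: cvg_cst.
  apply: (@continuous_comp _ _ _ (fun x => x - c) Num.sqrt); last exact: sqrt_continuous.
  by apply: cvgB; [exact: cvg_id|exact: cvg_cst].
- move=> x; rewrite in_itv/= => /andP[cx _]; have xc : 0 < x - c by rewrite subr_gt0.
  have d1 : is_derive x 1 (fun x => x - c) 1.
    by apply: is_derive_eq; rewrite subr0.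
  have d2 := @is_derive1_comp R Num.sqrt (fun x => x - c) x _ _ (is_derive1_sqrt xc) d1.
  have d3 := is_deriveM (is_derive_cst (2 : R) x 1) d2.
  apply: is_derive_eq d3 _; rewrite /GRing.scale/=; field.
  by rewrite gt_eqF// sqrtr_gt0.
Qed.

Lemma integrable_fS D : 0 < D -> mu.-integrable `[r_c D, 1] (EFin \o fS D).
Proof.
move=> D0; have c0 := r_c_gt0 D0; have cf := fS_oo_continuous D0 (lexx _).
have mf := oo_continuous_measurable cf.
apply/integrableP; split; first by apply/measurable_EFinP; exact: (measurable_fun_itv_cc mf).
under eq_integral do rewrite /= (ger0_norm (fS_ge0 _ _)).
rewrite integral_itv_bndoo; last exact: oo_continuous_emeasurable.
pose g x := (r_c D)^-1 * (Num.sqrt (x - r_c D))^-1.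
have ci : {in `]r_c D, 1%R[, continuous (fun x : R => (Num.sqrt (x - r_c D))^-1)}.
  move=> x; rewrite in_itv/= => /andP[cx _]; apply: cvgV.
    by rewrite gt_eqF// sqrtr_gt0 subr_gt0.
  apply: (@continuous_comp _ _ _ (fun x => x - r_c D) Num.sqrt); last exact: sqrt_continuous.
  by apply: cvgB; [exact: cvg_id|exact: cvg_cst].
apply: (@ge0_le_integral_oo_fin _ _ g) => //.
- by move=> x xc; apply: cvgM; [exact: cvg_cst|exact: ci].
- by move=> x; rewrite in_itv/= fS_ge0 => /fS_le->.
- rewrite /g; under eq_integral do rewrite EFinM.
  rewrite ge0_integralZl//.
  + by apply: lte_mul_pinfty; rewrite ?lee_fin ?invr_ge0 ?ltW// integral_invsqrt ?r_c_lt1.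
  + exact: oo_continuous_emeasurable.
  + by rewrite lee_fin invr_ge0 ltW.
Qed.

Lemma sweep_split D u : 0 < D -> r_c D <= u <= 1 ->
  \int[mu]_(v in `[r_c D, u]) fS D v = sweep D (r_c D) - sweep D u.
Proof.
move=> D0 /andP[cu u1]; have iF := integrable_fS D0.
have := Rintegral_itvB iF (_ : (BLeft (r_c D) <= BRight u)%O) (_ : (BRight u <= BRight 1)%O).
rewrite !bnd_simp => /(_ cu u1); rewrite Rintegral_itv_obnd_cbnd; last first.
  apply: integrableS iF => //; apply: subset_itvr; rewrite bnd_simp//.
by rewrite /sweep => <-; rewrite opprB addrC subrK.
Qed.

Lemma sweep1 D : sweep D 1 = 0.
Proof. by rewrite /sweep set_itv1 Rintegral_set1. Qed.

Lemma sweep_continuous D : 0 < D -> {within `[r_c D, 1], continuous (sweep D)}.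
Proof.
move=> D0; have iF := integrable_fS D0; have c1 := ltW (r_c_lt1 D0).
pose G u := sweep D (r_c D) - parameterized_integral mu (r_c D) u (fS D).
apply: (@subspace_eq_continuous _ _ _ G) => [u|].
  by rewrite inE/= in_itv/= => uI; rewrite /G /parameterized_integral sweep_split// opprB addrC subrK.
move=> x; apply: cvgB; first exact: cvg_cst.
exact: parameterized_integral_continuous.
Qed.

Lemma is_derive_sweep D u : 0 < D -> r_c D < u < 1 -> is_derive u 1 (sweep D) (- fS D u).
Proof.
move=> D0 /andP[cu u1]; have iF := integrable_fS D0.
have [dI dIE] := continuous_FTC1_closed u1 iF cu (fS_continuous D0 cu).
pose I x := \int[mu]_(t in `[r_c D, x]) fS D t.
have dI' : is_derive u 1 I (fS D u) by rewrite -dIE derive1E; exact/derivableP.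
have d := is_deriveB (is_derive_cst (sweep D (r_c D)) u 1) dI'.
have := is_derive_eq d (sub0r _); apply: near_eq_is_derive.
have /near_in_itvoo : u \in `]r_c D, 1[ by rewrite in_itv/= cu.
apply: filterS => v; rewrite in_itv/= => /andP[cv v1].
rewrite /I -[LHS]/(sweep D (r_c D) - \int[mu]_(t in `[r_c D, v]) fS D t).
by rewrite sweep_split ?(ltW cv) ?(ltW v1)// opprB addrC subrK.
Qed.

Lemma acos_continuous : {within `[(-1), 1], continuous (@acos R)}.
Proof.
rewrite -cospi -cos0; apply: segment_can_ge_continuous; first exact: pi_ge0.
  exact/continuous_subspaceT/continuous_cos.
exact: cosK.
Qed.

Lemma acos_lt (x y : R) : -1 <= x -> x < y -> y <= 1 -> acos y < acos x.
Proof.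
move=> x1 xy y1; have xI : -1 <= x <= 1 by rewrite x1 ltW// (lt_le_trans xy).
have yI : -1 <= y <= 1 by rewrite y1 (le_trans x1)// ltW.
by rewrite -ltr_cos ?in_itv/= ?acos_ge0 ?acos_lepi// !acosK.
Qed.

(** The boundary term of the integration by parts of [fS D].  With
    y = (tilt D u)^-2 one has fS D u du = (1 - u) / (3 - 2 u) * dy / (y sqrt (y - 1)),
    and dy / (y sqrt (y - 1)) is the differential of 2 acos (tilt D u). *)
Definition parts_term D u : R := 2 * (1 - u) / (3 - 2 * u) * acos (tilt D u).

Lemma tilt_bounds D u : 0 < D -> r_c D <= u <= 1 -> 0 <= tilt D u <= 1.
Proof.
move=> D0 /andP[]; rewrite le_eqVlt tilt_ge0 => /predU1P[<- _|cu u1].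
  by rewrite tilt_r_c// lexx.
by apply/ltW/tilt_lt1; rewrite ?cu.
Qed.

Lemma is_derive_parts_term D u : 0 < D -> r_c D < u < 1 ->
  is_derive u 1 (parts_term D) (fS D u - 2 / (3 - 2 * u) ^+ 2 * acos (tilt D u)).
Proof.
move=> D0 /andP[cu u1]; have c0 := r_c_gt0 D0.
have u0 : 0 < u by rewrite (lt_trans _ cu).
have t0 : 0 < tilt D u by rewrite tilt_gt0// u0.
have t1 : tilt D u < 1 by rewrite tilt_lt1// cu ltW.
have st : 0 < 1 - tilt D u ^+ 2 by rewrite subr_sqr_tilt_gt0 ?cu ?ltW.
have tI : -1 < tilt D u < 1 by rewrite t1 andbT (lt_trans _ t0)// ltrN10.
have da := @is_derive1_comp R acos (tilt D) u _ _ (is_derive1_acos tI)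
  (is_derive_tilt D0 (_ : 0 < u < 1)).
have u01 : 0 < u < 1 by rewrite u0.
have {}da := da u01.
have n3 : 3 - 2 * u != 0 by rewrite gt_eqF//; lra.
have dn : is_derive u 1 (fun u => 3 - 2 * u) (- 2).
  by apply: is_derive_eq; rewrite /GRing.scale/=; ring.
have dV := @is_deriveV R (fun u => 3 - 2 * u) u _ _ n3 dn.
have d1 : is_derive u 1 (fun u : R => 2 * (1 - u)) (- 2).
  by apply: is_derive_eq; rewrite /GRing.scale/=; ring.
have dm := is_deriveM d1 dV.
apply: (is_derive_eq (is_deriveM dm da)).
rewrite fS_tilt ?cu ?(ltW u1)// /GRing.scale/=.
have s0 : 0 < Num.sqrt (1 - tilt D u ^+ 2) by rewrite sqrtr_gt0.
rewrite -[_ * (fun y => _)]/((fun u : R => 2 * (1 - u) / (3 - 2 * u))) /=.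
set T := tilt D u in t0 s0 *; set S := Num.sqrt _ in s0 *; set A := acos _.
by field; rewrite n3 !gt_eqF// subr_gt0.
Qed.

Lemma cvg_at_leftW (T : Type) (F : set_system T) (f : T -> R) (l : R) : Filter F ->
  f @ F --> l -> (\forall x \near F, f x < l) -> f @ F --> l^'-.
Proof.
move=> FF fl fF P; rewrite /at_left /within /= => wP.
by apply: filterS2 fF (fl _ wP) => x /= fx; apply.
Qed.

Lemma parts_term_continuous D : 0 < D ->
  {within `[r_c D, 1], continuous (parts_term D)}.
Proof.
move=> D0; have c0 := r_c_gt0 D0; have c1 := r_c_lt1 D0.
have N11 : (-1 : R) < 1 by lra.
have [ac _ ac1] := (continuous_within_itvP (@acos R) N11).1 acos_continuous.
have cm u : u <= 1 -> {for u, continuous (fun u : R => 2 * (1 - u) / (3 - 2 * u))}.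
  move=> u1; apply: cvgM.
    by apply: cvgM; [exact: cvg_cst|apply: cvgB; [exact: cvg_cst|exact: cvg_id]].
  apply: cvgV; first by rewrite gt_eqF//; lra.
  by apply: cvgB; [exact: cvg_cst|apply: cvgM; [exact: cvg_cst|exact: cvg_id]].
have ct u : r_c D < u <= 1 -> {for u, continuous (fun u => acos (tilt D u))}.
  move=> cu; have u0 : 0 < u by case/andP: cu => /(lt_trans c0).
  apply: continuous_comp; first exact: tilt_continuous.
  by apply: ac; have := tilt_ge0 D u; rewrite in_itv/= tilt_lt1// andbT; lra.
apply/continuous_within_itvP => //; split.
- move=> u; rewrite in_itv/= => /andP[cu u1].
  by apply: cvgM; [exact/cm/ltW|apply: ct; rewrite cu ltW].
(* The tilt reaches 1, an end point of the domain of acos, at the turning radius;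
   at larger radii it is less than 1, so a limit from the left suffices. *)
- apply: cvgM; first exact/cvg_at_right_filter/cm/ltW.
  rewrite tilt_r_c//; apply: cvg_comp ac1; apply: cvg_at_leftW.
    by rewrite -(tilt_r_c D0); exact/cvg_at_right_filter/tilt_continuous.
  near=> u; apply: tilt_lt1 => //; apply/andP; split; near: u.
    exact: nbhs_right_gt.
  exact: nbhs_right_le.
- apply/cvg_at_left_filter; apply: cvgM; first exact: cm.
  by apply: ct; rewrite c1 lexx.
Unshelve. all: by end_near. Qed.

(** The half angle decreases with [D].  The function [H] below has the values
    [sweep E (r_c E)] at [r_c E] and 0 at 1, and its derivative
    - 2 / (3 - 2 u)^2 * acos (tilt E u) is more negative for smaller [E]. *)
Lemma sweep_r_c_lt D D' : 0 < D -> D < D' -> sweep D' (r_c D') < sweep D (r_c D).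
Proof.
move=> D0 DD'; have D'0 : 0 < D' by exact: lt_trans DD'.
have cc := r_c_lt D0 DD'; have c0 := r_c_gt0 D0; have c'1 := r_c_lt1 D'0.
pose H E u := sweep E u + parts_term E u.
have dH E u : 0 < E -> r_c E < u < 1 ->
    is_derive u 1 (H E) (- (2 / (3 - 2 * u) ^+ 2 * acos (tilt E u))).
  move=> E0 cu; apply: is_derive_eq.
    exact: (is_deriveD (is_derive_sweep E0 cu) (is_derive_parts_term E0 cu)).
  by rewrite addrA addNr add0r.
have cH E : 0 < E -> {within `[r_c E, 1], continuous (H E)}.
  move=> E0 x; apply: cvgD; first exact: sweep_continuous.
  exact: parts_term_continuous.
have Hc E : 0 < E -> H E (r_c E) = sweep E (r_c E).
  by move=> E0; rewrite /H /parts_term tilt_r_c// acos1 mulr0 addr0.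
have H1 E : H E 1 = 0.
  by rewrite /H /parts_term sweep1 subrr mulr0 mul0r mul0r addr0.
have w0 u : u < 1 -> 0 < 2 / (3 - 2 * u) ^+ 2.
  by move=> u1; rewrite divr_gt0// exprn_gt0//; lra.
(* On [r_c D', 1] the difference H D - H D' decreases to 0; on [r_c D, r_c D']
   the function H D does not increase. *)
rewrite -!Hc//; apply: (@lt_le_trans _ _ (H D (r_c D'))).
  rewrite -subr_gt0; pose K u := H D u - H D' u; rewrite -/(K _).
  have -> : 0 = K 1 by rewrite /K !H1 subrr.
  have dK u : u \in `]r_c D', 1[ -> is_derive u 1 K
      (- (2 / (3 - 2 * u) ^+ 2 * (acos (tilt D u) - acos (tilt D' u)))).
    rewrite in_itv/= => /andP[cu u1].
    have cDu : r_c D < u < 1 by rewrite (lt_trans cc).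
    have cD'u : r_c D' < u < 1 by rewrite cu.
    apply: is_derive_eq; first exact: (is_deriveB (dH _ _ D0 cDu) (dH _ _ D'0 cD'u)).
    by ring.
  apply: (ltr0_derive1_decr (a := r_c D') (b := 1)) => //.
  - by move=> u /dK[].
  - move=> u uI; have [_ dE] := dK u uI; rewrite derive1E dE oppr_lt0.
    move: uI; rewrite in_itv/= => /andP[cu u1].
    have u0 : 0 < u by rewrite (lt_trans _ cu)// (lt_trans c0).
    rewrite mulr_gt0 ?w0// subr_gt0 acos_lt//.
    + by rewrite (le_trans _ (tilt_ge0 _ _))// lerN10.
    + by rewrite tilt_lt// u0.
    + by rewrite ltW// tilt_lt1// cu ltW.
  - move=> x; apply: cvgB; last exact: cH.
    apply: continuous_subspaceW (cH _ D0) x; apply: subset_itvr.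
    by rewrite bnd_simp ltW.
apply: (ler0_derive1_nincr (a := r_c D) (b := r_c D')) => //; last exact: ltW.
- move=> u; rewrite in_itv/= => /andP[cu uc'].
  have cDu : r_c D < u < 1 by rewrite cu (lt_trans uc').
  by have [] := dH _ u D0 cDu.
- move=> u; rewrite in_itv/= => /andP[cu uc'].
  have u1 : u < 1 by rewrite (lt_trans uc').
  have cDu : r_c D < u < 1 by rewrite cu.
  have [_ dE] := dH _ u D0 cDu.
  rewrite derive1E dE oppr_le0 mulr_ge0 ?(ltW (w0 _ _))//.
  have /andP[t0 t1] : 0 <= tilt D u <= 1 by apply: tilt_bounds; rewrite ?(ltW cu) ?(ltW u1).
  by rewrite acos_ge0// t1 andbT (le_trans _ t0)// lerN10.
- by apply: continuous_subspaceW (cH _ D0); apply: subset_itvl; rewrite bnd_simp ltW.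
Qed.
End sweep.

(** * Travel times of strong arcs *)

Section time.
Context {R : realType}.
Implicit Types (D u e s : R).
Notation mu := (@lebesgue_measure R).

(** The reciprocal of the speed at radius [u]. *)
Definition slowness u : R := Num.sqrt (u / (1 - u)).
(** Flight time per unit of radius along a strong solution. *)
Definition radial_cost D u : R := slowness u / Num.sqrt (1 - tilt D u ^+ 2).
(** Flight time per radian along the circle of radius [e]. *)
Definition angular_cost e : R := e * slowness e.

Lemma slowness_gt0 u : 0 < u < 1 -> 0 < slowness u.
Proof. by move=> /andP[u0 u1]; rewrite sqrtr_gt0 divr_gt0 ?subr_gt0. Qed.

(** Snell's law: [u * slowness u * tilt D u] does not depend on [u], and the tilt
    is 1 at [r_c D]. *)
Lemma angular_cost_tilt D u : 0 < D -> 0 < u < 1 ->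
  angular_cost (r_c D) / u = slowness u * tilt D u.
Proof.
move=> D0 /andP[u0 u1]; have c0 := r_c_gt0 D0; have c1 := r_c_lt1 D0.
have u1' : 0 < 1 - u by rewrite subr_gt0.
have c1' : 0 < 1 - r_c D by rewrite subr_gt0.
apply/eqP; rewrite -(@eqrXn2 _ 2)//; last 2 first.
  by rewrite divr_ge0 ?mulr_ge0 ?sqrtr_ge0 ?ltW.
  by rewrite mulr_ge0 ?sqrtr_ge0.
rewrite /angular_cost expr_div_n !exprMn sqr_tilt ?u0 ?ltW// !sqr_sqrtr; last 2 first.
  by rewrite divr_ge0 ?ltW.
  by rewrite divr_ge0 ?ltW.
have -> : r_c D ^+ 2 * (r_c D / (1 - r_c D)) = 2 * D.
  by rewrite mulrA -exprSr r_cE//; field; rewrite gt_eqF.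
by apply/eqP; field; rewrite !gt_eqF.
Qed.

(** For x = cos alpha and y = cos beta this says that cos (alpha - beta) < 1. *)
Lemma cos_sub_lt1 (x y : R) : 0 <= x -> x < y -> y < 1 ->
  Num.sqrt (1 - y ^+ 2) * Num.sqrt (1 - x ^+ 2) + x * y < 1.
Proof.
move=> x0 xy y1.
have x2 : 0 <= 1 - x ^+ 2 by rewrite subr_ge0 expr_le1// ltW// (lt_trans xy).
have y2 : 0 <= 1 - y ^+ 2 by rewrite subr_ge0 expr_le1// ltW// (le_lt_trans x0).
have := sqr_sqrtr x2; have := sqr_sqrtr y2.
set A := Num.sqrt _; set B := Num.sqrt _ => A2 B2.
have := sqr_ge0 (A - B); have : 0 < (y - x) ^+ 2 by rewrite exprn_gt0// subr_gt0.
by rewrite !sqrrB A2 B2; lra.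
Qed.

Lemma radial_cost_gt0 D u : 0 < D -> r_c D < u < 1 -> 0 < radial_cost D u.
Proof.
move=> D0 /andP[cu u1]; rewrite divr_gt0 ?slowness_gt0 ?u1 ?andbT ?(lt_trans _ cu) ?r_c_gt0//.
by rewrite sqrtr_gt0 subr_sqr_tilt_gt0// cu ltW.
Qed.

(** At every radius, the smaller parameter [D] gains less time on the arc than it
    loses on the circle, to which it leaves a larger angle.  Up to the factor
    [slowness u / sqrt (1 - tilt D u ^+ 2)], the difference of the two sides is
    the one in [cos_sub_lt1]. *)
Lemma cost_lt D D' u : 0 < D -> D < D' -> r_c D' < u < 1 ->
  radial_cost D' u + angular_cost (r_c D') * fS D u <
  radial_cost D u + angular_cost (r_c D') * fS D' u.
Proof.
move=> D0 DD' /andP[cu u1]; have D'0 : 0 < D' by exact: lt_trans DD'.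
have cDu : r_c D < u by rewrite (lt_trans (r_c_lt D0 DD')).
have u0 : 0 < u by rewrite (lt_trans _ cu) ?r_c_gt0.
have x0 : 0 < tilt D u by rewrite tilt_gt0 ?u0.
have xy : tilt D u < tilt D' u by rewrite tilt_lt ?u0.
have y1 : tilt D' u < 1 by rewrite tilt_lt1// cu ltW.
have x2 : 0 < 1 - tilt D u ^+ 2 by rewrite subr_sqr_tilt_gt0 ?cDu ?ltW.
have y2 : 0 < 1 - tilt D' u ^+ 2 by rewrite subr_sqr_tilt_gt0 ?cu ?ltW.
have h := cos_sub_lt1 (ltW x0) xy y1.
have kE : angular_cost (r_c D') = slowness u * tilt D' u * u.
  by rewrite -angular_cost_tilt ?u0// divfK// gt_eqF.
rewrite !fS_tilt ?cDu ?cu ?(ltW u1)// kE /radial_cost.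
have w0 : 0 < slowness u by rewrite slowness_gt0 ?u0.
have := sqr_sqrtr (ltW x2); have := sqr_sqrtr (ltW y2).
have X0 : 0 < Num.sqrt (1 - tilt D u ^+ 2) by rewrite sqrtr_gt0.
have Y0 : 0 < Num.sqrt (1 - tilt D' u ^+ 2) by rewrite sqrtr_gt0.
move: h X0 Y0 x0; set X := Num.sqrt _; set Y := Num.sqrt _.
set x := tilt D u; set y := tilt D' u; set w := slowness u in w0 * => h X0 Y0 x0 X2 Y2.
rewrite -subr_gt0.
have -> : w / Y + w * y * u * (y / (u * X)) - (w / X + w * y * u * (x / (u * Y))) =
    w / Y * (1 - (X * Y + x * y)).
  transitivity (w / Y * (1 - x * y) - w * (1 - y ^+ 2) / X).
    by field; rewrite !gt_eqF.
  by rewrite -X2; field; rewrite !gt_eqF.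
by rewrite mulr_gt0 ?divr_gt0 ?subr_gt0.
Qed.

(** An integrable majorant: the last term is integrable at 1, the first one at
    the turning radius. *)
Lemma cost_le D u : 0 < D -> r_c D < u < 1 ->
  radial_cost D u <= angular_cost (r_c D) * fS D u + (Num.sqrt (1 - u))^-1.
Proof.
move=> D0 /andP[cu u1].
have u0 : 0 < u by rewrite (lt_trans _ cu) ?r_c_gt0.
have y1 : tilt D u < 1 by rewrite tilt_lt1// cu ltW.
have y2 : 0 < 1 - tilt D u ^+ 2 by rewrite subr_sqr_tilt_gt0 ?cu ?ltW.
have kE : angular_cost (r_c D) = slowness u * tilt D u * u.
  by rewrite -angular_cost_tilt ?u0// divfK// gt_eqF.
rewrite fS_tilt ?cu ?(ltW u1)// kE /radial_cost.
have w0 : 0 < slowness u by rewrite slowness_gt0 ?u0.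
have wle : slowness u <= (Num.sqrt (1 - u))^-1.
  have u1' : 0 < 1 - u by rewrite subr_gt0.
  by rewrite /slowness -sqrtrV ?(ltW u1')// ler_wsqrtr// ler_piMl ?invr_ge0 ?ltW.
apply: le_trans (lerD (lexx _) wle).
have X0 : 0 < Num.sqrt (1 - tilt D u ^+ 2) by rewrite sqrtr_gt0.
have X2 := sqr_sqrtr (ltW y2).
have X1 : Num.sqrt (1 - tilt D u ^+ 2) <= 1.
  by rewrite -[leRHS]sqrtr1 ler_wsqrtr// gerBl sqr_ge0.
set X := Num.sqrt (1 - tilt D u ^+ 2) in X0 X1 X2 *; set y := tilt D u in X2 *.
set w := slowness u in w0 *.
rewrite -subr_ge0.
have -> : w * y * u * (y / (u * X)) + w - w / X = w - w * (1 - y ^+ 2) / X.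
  by field; rewrite !gt_eqF.
rewrite -X2 expr2 mulrA mulfK ?gt_eqF//.
by rewrite subr_ge0 ger_pMr.
Qed.

Lemma slowness_continuous u : u < 1 -> {for u, continuous slowness}.
Proof.
move=> u1; apply: (@continuous_comp _ _ _ (fun u => u / (1 - u)) Num.sqrt).
  apply: cvgM; first exact: cvg_id.
  apply: cvgV; first by rewrite subr_eq0 eq_sym lt_eqF.
  by apply: cvgB; [exact: cvg_cst|exact: cvg_id].
exact: sqrt_continuous.
Qed.

Lemma radial_cost_continuous D u : 0 < D -> r_c D < u < 1 ->
  {for u, continuous (radial_cost D)}.
Proof.
move=> D0 /andP[cu u1]; have u0 : 0 < u by rewrite (lt_trans _ cu) ?r_c_gt0.
have y2 : 0 < 1 - tilt D u ^+ 2 by rewrite subr_sqr_tilt_gt0 ?cu ?ltW.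
apply: cvgM; first exact: slowness_continuous.
apply: cvgV; first by rewrite gt_eqF ?sqrtr_gt0.
apply: (@continuous_comp _ _ _ (fun u => 1 - tilt D u ^+ 2) Num.sqrt); last exact: sqrt_continuous.
apply: cvgB; first exact: cvg_cst.
apply: (@continuous_comp _ _ _ (tilt D) (fun x => x ^+ 2)); first exact: tilt_continuous.
exact: exprn_continuous.
Qed.

Lemma within_continuous_comp (f g : R -> R) (A B : set R) :
  {within A, continuous f} -> continuous g -> (forall x, B x -> A (g x)) ->
  {within B, continuous (f \o g)}.
Proof.
move=> /subspace_continuousP cf cg BA; apply/subspace_continuousP => x Bx P Pf.
have fP : nbhs (g x) (fun y => A y -> P (f y)) := cf _ (BA _ Bx) _ Pf.
change (nbhs x (fun y => B y -> P (f (g y)))).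
have : nbhs x (fun y => A (g y) -> P (f (g y))) := cg x _ fP.
apply: filterS => y /= h By; exact: (h (BA _ By)).
Qed.

(** The radius of the two strong arcs of a curve of the family is an affine
    function of the parameter, decreasing on the first arc and increasing on the
    last one; this covers both cases. *)
Definition radial_motion (p q m : R) (rho : R -> R) e :=
  [/\ p < q, forall s, rho s = rho p + m * (s - p) &
  m < 0 /\ rho p = 1 /\ rho q = e \/ 0 < m /\ rho p = e /\ rho q = 1].

Section arc.
Variables (p q m : R) (rho : R -> R) (e : R).
Hypothesis rho_motion : radial_motion p q m rho e.
Hypothesis e01 : 0 < e < 1.

Lemma motion_oo s : s \in `]p, q[ -> e < rho s < 1.
Proof.
have [pq rE H] := rho_motion; have qE := rE q.
rewrite in_itv/= rE => /andP[ps sq]; case: H => -[m0 [hp hq]].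
- have : m * (s - p) < 0 by rewrite nmulr_rlt0// subr_gt0.
  have : m * (s - q) > 0 by rewrite nmulr_rgt0// subr_lt0.
  by lra.
- have : m * (s - p) > 0 by rewrite mulr_gt0// subr_gt0.
  have : m * (s - q) < 0 by rewrite pmulr_rlt0// subr_lt0.
  by lra.
Qed.

Lemma motion_cc s : s \in `[p, q] -> e <= rho s <= 1.
Proof.
have [pq rE H] := rho_motion; have /andP[e0 e1] := e01.
have [-> _|sp] := eqVneq s p; first by case: H => -[_ [-> _]]; rewrite lexx ltW.
have [-> _|sq] := eqVneq s q; first by case: H => -[_ [_ ->]]; rewrite lexx ltW.
rewrite in_itv/= => /andP[ps sq'].
have /motion_oo/andP[h1 h2] : s \in `]p, q[ by rewrite in_itv/= !lt_neqAle ps sq' eq_sym sp sq.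
by rewrite !ltW.
Qed.

Lemma is_derive_motion s : is_derive s 1 rho m.
Proof.
have [pq rE H] := rho_motion.
have d : is_derive s 1 (fun s => rho p + m * (s - p)) m.
  by apply: is_derive_eq; rewrite /GRing.scale/=; ring.
by rewrite (_ : rho = (fun s => rho p + m * (s - p))) //; apply/funext.
Qed.

Lemma motion_continuous : continuous rho.
Proof.
move=> s; have [d _] := is_derive_motion s.
exact/differentiable_continuous/derivable1_diffP.
Qed.

(** Change of variable from the parameter to the radius, for an integrand with
    an explicit primitive that may be infinite at both ends. *)
Lemma integral_motion (F f : R -> R) : {within `[e, 1], continuous F} ->
  (forall u, u \in `]e, 1[ -> is_derive u 1 F (- f u)) ->
  (forall u, u \in `]e, 1[ -> {for u, continuous f}) ->
  (forall u, u \in `]e, 1[ -> 0 <= f u) ->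
  (\int[mu]_(s in `]p, q[) (`|m| * f (rho s))%:E = (F e - F 1)%:E)%E.
Proof.
move=> cF dF cf f0; have [pq rE H] := rho_motion.
have inr s : s \in `]p, q[ -> rho s \in `]e, 1[.
  by move=> /motion_oo; rewrite in_itv.
have cg : {in `]p, q[, continuous (fun s => `|m| * f (rho s))}.
  move=> s spq; apply: cvgM; first exact: cvg_cst.
  by apply: continuous_comp; [exact: motion_continuous|exact/cf/inr].
rewrite -(@integral_itv_bndoo _ _ _ _ true false); last exact: oo_continuous_emeasurable.
pose P s := - Num.sg m * F (rho s).
rewrite (_ : F e - F 1 = P q - P p); last first.
  rewrite /P; case: H => -[m0 [-> ->]].
    by rewrite ltr0_sg// opprK !mul1r.
  by rewrite gtr0_sg// !mulN1r opprK addrC.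
have cP : {within `[p, q], continuous P}.
  move=> s; apply: cvgM; first exact: cvg_cst.
  apply: (@within_continuous_comp F rho _ _ cF motion_continuous) => x /=.
  by move=> /motion_cc; rewrite in_itv.
have dP s : s \in `]p, q[ -> is_derive s 1 P (`|m| * f (rho s)).
  move=> spq.
  have d := @is_derive1_comp R F rho s _ _ (dF _ (inr _ spq)) (is_derive_motion s).
  have d' := is_deriveM (is_derive_cst (- Num.sg m) s 1) d.
  apply: is_derive_eq d' _; rewrite /GRing.scale/= mulr0 addr0.
  by rewrite [in RHS]normrEsg; ring.
apply: integral_derive_oo pq cP dP cg _ => s /inr/f0 ?.
exact: mulr_ge0.
Qed.

Lemma integral_motion_fS D : 0 < D -> r_c D <= e ->
  (\int[mu]_(s in `]p, q[) (`|m| * fS D (rho s))%:E = (sweep D e)%:E)%E.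
Proof.
move=> D0 ce.
transitivity (sweep D e - sweep D 1)%:E; last by rewrite sweep1 subr0.
apply: (@integral_motion (sweep D) (fS D)).
- by apply: continuous_subspaceW (sweep_continuous D0); apply: subset_itvr; rewrite bnd_simp.
- move=> u; rewrite in_itv/= => /andP[eu u1].
  by apply: is_derive_sweep; rewrite // u1 (le_lt_trans ce).
- move=> u; rewrite in_itv/= => /andP[eu u1].
  by apply: fS_continuous; rewrite // (le_lt_trans ce).
- by move=> u _; exact: fS_ge0.
Qed.

Lemma arc_cost_fin D : 0 < D -> r_c D = e ->
  (\int[mu]_(s in `]p, q[) (`|m| * radial_cost D (rho s))%:E < +oo)%E.
Proof.
move=> D0 cE; have [pq rE H] := rho_motion.
(* The majorant of [cost_le], which has the explicit primitive F below. *)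
pose h u := angular_cost e * fS D u + (Num.sqrt (1 - u))^-1.
have ch u : u \in `]e, 1[ -> {for u, continuous h}.
  rewrite in_itv/= => /andP[eu u1]; apply: cvgD.
    by apply: cvgM; [exact: cvg_cst|apply: fS_continuous; rewrite // cE].
  apply: cvgV; first by rewrite gt_eqF// sqrtr_gt0 subr_gt0.
  apply: (@continuous_comp _ _ _ (fun u => 1 - u) Num.sqrt); last exact: sqrt_continuous.
  by apply: cvgB; [exact: cvg_cst|exact: cvg_id].
have inr s : s \in `]p, q[ -> rho s \in `]e, 1[.
  by move=> /motion_oo; rewrite in_itv.
have k0 : 0 <= angular_cost e.
  by have /andP[e0 e1] := e01; rewrite mulr_ge0 ?sqrtr_ge0 ?ltW.
have h0 u : u \in `]e, 1[ -> 0 <= h u.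
  by move=> _; rewrite addr_ge0 ?invr_ge0 ?sqrtr_ge0// mulr_ge0 ?fS_ge0.
apply: (@ge0_le_integral_oo_fin _ _ (fun s => `|m| * h (rho s))).
- move=> s /inr; rewrite in_itv/= => /andP[eu u1].
  apply: cvgM; first exact: cvg_cst.
  apply: continuous_comp; first exact: motion_continuous.
  by apply: radial_cost_continuous; rewrite // cE eu.
- move=> s /inr sr; apply: cvgM; first exact: cvg_cst.
  by apply: continuous_comp; [exact: motion_continuous|exact: ch].
- move=> s /inr; rewrite in_itv/= -cE => sr.
  rewrite mulr_ge0 ?(ltW (radial_cost_gt0 _ _))//= ler_wpM2l// /h -cE.
  exact: cost_le.
pose F u := angular_cost e * sweep D u + 2 * Num.sqrt (1 - u).
have -> : (\int[mu]_(s in `]p, q[) (`|m| * h (rho s))%:E = (F e - F 1)%:E)%E; last exact: ltry.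
apply: (@integral_motion F h) => //.
- move=> x; apply: cvgD.
    by apply: cvgM; [exact: cvg_cst|rewrite -cE; exact: sweep_continuous].
  apply: cvgM; first exact: cvg_cst.
  apply: continuous_subspaceT => {}x.
  apply: (@continuous_comp _ _ _ (fun u => 1 - u) Num.sqrt); last exact: sqrt_continuous.
  by apply: cvgB; [exact: cvg_cst|exact: cvg_id].
- move=> u; rewrite in_itv/= => /andP[eu u1].
  have ds : is_derive u 1 (sweep D) (- fS D u) by apply: is_derive_sweep; rewrite // cE eu.
  have u1' : 0 < 1 - u by rewrite subr_gt0.
  have d1 : is_derive u 1 (fun u : R => 1 - u) (- 1).
    by apply: is_derive_eq; ring.
  have d2 := @is_derive1_comp R Num.sqrt (fun u => 1 - u) u _ _ (is_derive1_sqrt u1') d1.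
  have d3 := is_deriveM (is_derive_cst (2 : R) u 1) d2.
  have d4 := is_deriveM (is_derive_cst (angular_cost e) u 1) ds.
  apply: is_derive_eq (is_deriveD d4 d3) _; rewrite /GRing.scale/= /h; field.
  by rewrite gt_eqF// sqrtr_gt0.
Qed.

(** [cost_lt] integrated over an arc. *)
Lemma arc_cost_lt D D' : 0 < D -> D < D' -> r_c D' = e ->
  (\int[mu]_(s in `]p, q[) (`|m| * radial_cost D' (rho s))%:E +
     (angular_cost e * sweep D e)%:E <
   \int[mu]_(s in `]p, q[) (`|m| * radial_cost D (rho s))%:E +
     (angular_cost e * sweep D' e)%:E)%E.
Proof.
move=> D0 DD' cE; have [pq rE H] := rho_motion.
have D'0 : 0 < D' by exact: lt_trans DD'.
have ce : r_c D < e by rewrite -cE; exact: r_c_lt.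
have inr s : s \in `]p, q[ -> rho s \in `]e, 1[.
  by move=> /motion_oo; rewrite in_itv.
have k0 : 0 <= angular_cost e.
  by have /andP[e0 e1] := e01; rewrite mulr_ge0 ?sqrtr_ge0 ?ltW.
have m0 : 0 < `|m| by rewrite normr_gt0; case: H => -[m0 _]; [rewrite lt_eqF|rewrite gt_eqF].
have cg E E' : 0 < E -> r_c E <= e -> 0 < E' -> r_c E' <= e ->
    {in `]p, q[, continuous (fun s =>
       `|m| * (radial_cost E (rho s) + angular_cost e * fS E' (rho s)))}.
  move=> E0 Ee E'0 E'e s /inr; rewrite in_itv/= => /andP[eu u1].
  apply: cvgM; first exact: cvg_cst.
  apply: (@continuous_comp _ _ _ rho
    (fun u => radial_cost E u + angular_cost e * fS E' u)); first exact: motion_continuous.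
  apply: cvgD; first by apply: radial_cost_continuous; rewrite // u1 (le_lt_trans Ee).
  by apply: cvgM; [exact: cvg_cst|apply: fS_continuous; rewrite // (le_lt_trans E'e)].
have split E E' : 0 < E -> r_c E <= e -> 0 < E' -> r_c E' <= e ->
    (\int[mu]_(s in `]p, q[) (`|m| * radial_cost E (rho s))%:E +
       (angular_cost e * sweep E' e)%:E =
     \int[mu]_(s in `]p, q[)
       (`|m| * (radial_cost E (rho s) + angular_cost e * fS E' (rho s)))%:E)%E.
  move=> E0 Ee E'0 E'e.
  rewrite EFinM -(integral_motion_fS E'0 E'e).
  have cr : {in `]p, q[, continuous (fun s => `|m| * radial_cost E (rho s))}.
    move=> s /inr; rewrite in_itv/= => /andP[eu u1].
    apply: cvgM; first exact: cvg_cst.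
    apply: continuous_comp; first exact: motion_continuous.
    by apply: radial_cost_continuous; rewrite // u1 (le_lt_trans Ee).
  have cf : {in `]p, q[, continuous (fun s => `|m| * fS E' (rho s))}.
    move=> s /inr; rewrite in_itv/= => /andP[eu u1].
    apply: cvgM; first exact: cvg_cst.
    apply: continuous_comp; first exact: motion_continuous.
    by apply: fS_continuous; rewrite // (le_lt_trans E'e).
  rewrite -ge0_integralZl//; last 2 first.
  - exact: oo_continuous_emeasurable.
  - by move=> s _; rewrite lee_fin mulr_ge0// fS_ge0.
  rewrite -ge0_integralD//.
  - by apply: eq_integral => s _; rewrite -EFinM -EFinD; congr (_%:E); ring.
  - move=> s /inr; rewrite in_itv/= => /andP[eu u1].
    by rewrite lee_fin mulr_ge0// ltW// radial_cost_gt0// u1 (le_lt_trans Ee).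
  - exact: oo_continuous_emeasurable.
  - by move=> s _; rewrite mule_ge0 ?lee_fin// mulr_ge0 ?fS_ge0.
  - apply: emeasurable_funM; first exact: measurable_cst.
    exact: oo_continuous_emeasurable.
rewrite !split ?cE ?lexx ?(ltW ce)//.
apply: lt_integral_oo => //.
- by apply: cg; rewrite ?cE ?lexx ?(ltW ce).
- by apply: cg; rewrite ?cE ?lexx ?(ltW ce).
- move=> s /inr; rewrite in_itv/= -cE => sr.
  rewrite ltr_pM2l// cost_lt// andbT mulr_ge0// addr_ge0//.
    by rewrite ltW// radial_cost_gt0.
  by rewrite mulr_ge0 ?fS_ge0// cE.
- rewrite -split ?cE ?(ltW ce)//.
  by rewrite lte_add_pinfty ?ltry// arc_cost_fin.
Qed.

End arc.
End time.

(** * The flight time of the family *)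

Section family.
Context {R : realType}.
Implicit Types (D u e s tf : R) (a : R -> R * R).
Notation mu := (@lebesgue_measure R).

Definition flight_density a s : \bar R :=
  ((enorm (velocity a s))%:E / sqrte ((enorm (a s))%:E^-1 - 1))%E.

Lemma flight_density_ge0 a s : (0 <= flight_density a s)%E.
Proof.
by rewrite mule_ge0 ?lee_fin ?sqrtr_ge0// inve_ge0 sqrte_ge0.
Qed.

Lemma enorm_polar (r t : R) : 0 <= r -> enorm (polar r t) = r.
Proof.
move=> r0; rewrite /enorm /dotp/=.
have -> : r * cos t * (r * cos t) + r * sin t * (r * sin t) = r ^+ 2.
  transitivity (r ^+ 2 * (cos t ^+ 2 + sin t ^+ 2)); first by ring.
  by rewrite cos2Dsin2 mulr1.
by rewrite sqrtr_sqr ger0_norm.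
Qed.

Lemma flight_density_polar a (rho th : R -> R) s dr dth :
  (\near s, a s = polar (rho s) (th s)) ->
  is_derive s 1 rho dr -> is_derive s 1 th dth -> 0 < rho s < 1 ->
  flight_density a s = (Num.sqrt (dr ^+ 2 + (rho s * dth) ^+ 2) * slowness (rho s))%:E.
Proof.
move=> anear drho dthe /andP[r0 r1].
have as_ : a s = polar (rho s) (th s) by exact: nbhs_singleton anear.
have dcos := @is_derive1_comp R cos th s _ _ (is_derive_cos _) dthe.
have dsin := @is_derive1_comp R sin th s _ _ (is_derive_sin _) dthe.
have d1 : (fun x => (a x).1)^`()%classic s =
    rho s * (- sin (th s) * dth) + cos (th s) * dr.
  have [_ <-] := is_deriveM drho dcos.
  rewrite derive1E; apply: near_eq_derive.
  by apply: filterS anear => x ->.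
have d2 : (fun x => (a x).2)^`()%classic s =
    rho s * (cos (th s) * dth) + sin (th s) * dr.
  have [_ <-] := is_deriveM drho dsin.
  rewrite derive1E; apply: near_eq_derive.
  by apply: filterS anear => x ->.
rewrite /flight_density as_ enorm_polar ?ltW// inver gt_eqF//.
have r1' : 0 < (rho s)^-1 - 1 by rewrite subr_gt0 invf_gt1.
rewrite -EFinB /= inver gt_eqF ?sqrtr_gt0// -EFinM; congr (_%:E).
congr (_ * _).
  rewrite /enorm /dotp /velocity/= d1 d2; congr (Num.sqrt _).
  transitivity ((dr ^+ 2 + (rho s * dth) ^+ 2) * (cos (th s) ^+ 2 + sin (th s) ^+ 2)).
    by ring.
  by rewrite cos2Dsin2 mulr1.
rewrite -sqrtrV ?(ltW r1')//; congr (Num.sqrt _); field.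
rewrite !gt_eqF//= ?subr_gt0//.
Qed.

(** On a strong arc the speed of the parametrization is its radial speed divided
    by the cosine of the tilt angle. *)
Lemma flight_density_strong a (rho th : R -> R) D s m dth :
  0 < D -> r_c D < rho s < 1 ->
  (\near s, a s = polar (rho s) (th s)) ->
  is_derive s 1 rho m -> is_derive s 1 th dth -> `|dth| = `|m| * fS D (rho s) ->
  flight_density a s = (`|m| * radial_cost D (rho s))%:E.
Proof.
move=> D0 /andP[cu u1] an dr dt dtE; set u := rho s in cu u1 *.
have u0 : 0 < u by rewrite (lt_trans _ cu) ?r_c_gt0.
rewrite (flight_density_polar an dr dt) -/u ?u0//; congr (_%:E).
rewrite /radial_cost -/u.
have y2 : 0 < 1 - tilt D u ^+ 2 by rewrite subr_sqr_tilt_gt0 ?cu ?ltW.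
have y0 : 0 < Num.sqrt (1 - tilt D u ^+ 2) by rewrite sqrtr_gt0.
have -> : m ^+ 2 + (u * dth) ^+ 2 = (`|m| / Num.sqrt (1 - tilt D u ^+ 2)) ^+ 2.
  rewrite exprMn -(real_normK (num_real dth)) -(real_normK (num_real m)) dtE -/u.
  rewrite fS_tilt ?cu ?(ltW u1)//; have := sqr_sqrtr (ltW y2); move: y0.
  set Y := Num.sqrt _; set x := tilt D u; set M := `|m| => y0 Y2.
  transitivity (M ^+ 2 * (Y ^+ 2 + x ^+ 2) / Y ^+ 2); first by field; rewrite !gt_eqF.
  by rewrite [in Y ^+ 2 + _]Y2 subrK; field; rewrite gt_eqF.
by rewrite sqrtr_sqr (ger0_norm (divr_ge0 (normr_ge0 m) (ltW y0))); ring.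
Qed.


(** The radius on the first third of a curve of the family.  It does not depend
    on [D], because the parameter is rescaled by [s_hit e D]: this is what makes
    curves with different [D] comparable at equal parameters. *)
Definition inward e s : R := 1 - 3 * (1 - e) * s.
Definition outward e s : R := e + 3 * (1 - e) * (s - 2 / 3).

Lemma inward_motion e : 0 < e < 1 -> radial_motion 0 (1 / 3) (- (3 * (1 - e))) (inward e) e.
Proof.
move=> /andP[e0 e1]; split; first by lra.
  by move=> s; rewrite /inward; ring.
by left; rewrite /inward; split; [lra|split; field].
Qed.

Lemma outward_motion e : 0 < e < 1 -> radial_motion (2 / 3) 1 (3 * (1 - e)) (outward e) e.
Proof.
move=> /andP[e0 e1]; split; first by lra.
  by move=> s; rewrite /outward; ring.
by right; rewrite /outward; split; [lra|split; field].
Qed.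

Lemma rS_half D : rS D (1 / 2) = r_c D.
Proof. by rewrite /rS lexx; field. Qed.

Lemma rS1 D : rS D 1 = 1.
Proof. by rewrite /rS ifF; [ring|apply/negbTE; rewrite -ltNge; lra]. Qed.

Lemma thetaS_first D s : s <= 1 / 2 -> thetaS D s = sweep D (rS D s).
Proof. by move=> s2; rewrite /thetaS s2. Qed.

Lemma thetaS_halfE D : thetaS_half D = sweep D (r_c D).
Proof. by rewrite /thetaS_half rS_half. Qed.

Lemma thetaS_last D s : 0 < D -> 1 / 2 < s <= 1 ->
  thetaS D s = 2 * sweep D (r_c D) - sweep D (rS D s).
Proof.
move=> D0 /andP[s2 s1]; rewrite /thetaS leNgt s2/= thetaS_halfE sweep_split//.
  by ring.
have c1 := r_c_lt1 D0; rewrite /rS ifF; last by apply/negbTE; rewrite -ltNge.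
have : 0 <= (1 - r_c D) * (2 * s - 1) by rewrite mulr_ge0//; lra.
have : 0 <= (1 - r_c D) * (1 - s) by rewrite mulr_ge0//; lra.
by lra.
Qed.

Lemma thetaS1 D : 0 < D -> thetaS D 1 = 2 * sweep D (r_c D).
Proof.
by move=> D0; rewrite thetaS_last ?rS1 ?sweep1 ?subr0// lexx andbT; lra.
Qed.

Lemma s_hitE D e : 0 < D -> r_c D <= e -> e < 1 ->
  s_hit e D = (1 - e) / (2 * (1 - r_c D)).
Proof.
move=> D0 ce e1; have c1 : 0 < 1 - r_c D by rewrite subr_gt0 r_c_lt1.
set S := RHS.
have SE : 2 * (1 - r_c D) * S = 1 - e by rewrite /S; field; rewrite gt_eqF.
have S0 : 0 <= S by rewrite divr_ge0 ?subr_ge0 ?mulr_ge0 ?ltW.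
have S2 : S <= 1 / 2.
  by rewrite /S ler_pdivrMr ?mulr_gt0//; lra.
have hit s : s <= 1 / 2 -> rS D s = e -> s = S.
  move=> s2; rewrite /rS s2 => E.
  apply: (@mulfI _ (2 * (1 - r_c D))); first by rewrite gt_eqF ?mulr_gt0.
  by rewrite SE; lra.
have Shit : rS D S = e by rewrite /rS S2; lra.
have S01 : 0 <= S <= 1 by rewrite S0/=; lra.
rewrite /s_hit; set P := [set s | _].
(* The strong solution also has radius e on its outward half; the least
   such parameter is at most S <= 1 / 2, hence on the inward half. *)
have [[/andP[h0 h1] hE] hmin] : P (get P).
  apply: getPex; exists S; split=> // s /andP[s0 s1] sE.
  by have [/hit -> //|] := leP s (1 / 2); lra.
by apply: hit => //; apply: le_trans S2; exact: hmin.
Qed.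

Section piece.
Variables (e tf D : R).
Hypotheses (e01 : 0 < e < 1) (D0 : 0 < D) (ce : r_c D <= e).

Let c1 : 0 < 1 - r_c D. Proof. by rewrite subr_gt0 r_c_lt1. Qed.

Let hitM : 2 * (1 - r_c D) * s_hit e D = 1 - e.
Proof. by have /andP[_ e1] := e01; rewrite s_hitE//; field; rewrite gt_eqF. Qed.

Let hit_gt0 : 0 < s_hit e D.
Proof.
have /andP[_ e1] := e01.
by rewrite s_hitE// divr_gt0 ?subr_gt0 ?mulr_gt0.
Qed.

Let hit_le2 : s_hit e D <= 1 / 2.
Proof.
have c2 : 0 < 2 * (1 - r_c D) by rewrite mulr_gt0.
by rewrite -(ler_pM2l c2) hitM; move: ce; lra.
Qed.

Lemma thetaS_hit : thetaS D (s_hit e D) = sweep D e.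
Proof. by rewrite thetaS_first// /rS hit_le2; congr (sweep D _); move: hitM; lra. Qed.

Lemma family_curve_in s : s < 1 / 3 ->
  family_curve e tf D s = polar (inward e s) (sweep D (inward e s)).
Proof.
move=> s3; rewrite /family_curve s3/=.
have h2 : 3 * s_hit e D * s <= 1 / 2.
  apply: le_trans hit_le2; rewrite mulrAC ger_pMl//; lra.
have E : rS D (3 * s_hit e D * s) = inward e s.
  by rewrite /rS h2 /inward -hitM; ring.
by rewrite thetaS_first// E.
Qed.

Lemma family_curve_circle s : 1 / 3 <= s <= 2 / 3 ->
  family_curve e tf D s =
  polar e (3 * (tf - 2 * sweep D e) * s + 3 * sweep D e - tf).
Proof.
by move=> /andP[s3 s23]; rewrite /family_curve ltNge s3/= s23 thetaS_hit.
Qed.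

Lemma family_curve_out s : 2 / 3 < s <= 1 ->
  family_curve e tf D s = polar (outward e s) (tf - sweep D (outward e s)).
Proof.
move=> /andP[s3 s1]; rewrite /family_curve.
rewrite ifF; last by apply/negbTE; rewrite -leNgt; lra.
rewrite ifF; last by apply/negbTE; rewrite -ltNge.
set j := 3 * s_hit e D * s + 1 - 3 * s_hit e D.
have j1 : 1 / 2 < j.
  have : 0 < s_hit e D * (3 * s - 2) by rewrite mulr_gt0//; lra.
  by move: hit_le2; rewrite /j; lra.
have j2 : j <= 1.
  have : 0 <= s_hit e D * (1 - s) by apply: mulr_ge0; [exact: ltW|lra].
  by rewrite /j; lra.
have E : rS D j = outward e s.
  rewrite /rS leNgt j1/=; transitivity (1 - (1 - e) * (3 * (1 - s))).
    by rewrite -hitM /j; ring.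
  by rewrite /outward; field.
by rewrite thetaS1// thetaS_last ?j1// E; congr (polar _ _); ring.
Qed.

Lemma flight_density_in s : s \in `]0, 1 / 3[ ->
  flight_density (family_curve e tf D) s =
  (`|- (3 * (1 - e))| * radial_cost D (inward e s))%:E.
Proof.
move=> sI; have := motion_oo (inward_motion e01) sI; move=> /andP[r0 r1].
have rI : r_c D < inward e s < 1 by rewrite (le_lt_trans ce).
have dr := is_derive_motion (inward_motion e01) s.
have dt := @is_derive1_comp R (sweep D) (inward e) s _ _ (is_derive_sweep D0 rI) dr.
apply: (flight_density_strong D0 rI _ dr dt).
  apply: filterS (near_in_itvoo sI) => x; rewrite in_itv/= => /andP[x1 x2].
  by rewrite family_curve_in.
by rewrite normrM normrN mulrC (ger0_norm (fS_ge0 _ _)).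
Qed.

Lemma flight_density_circle s : s \in `]1 / 3, 2 / 3[ ->
  flight_density (family_curve e tf D) s =
  (angular_cost e * (3 * `|tf - 2 * sweep D e|))%:E.
Proof.
move=> sI; have /andP[e0 e1] := e01.
have dt : is_derive s 1 (fun s => 3 * (tf - 2 * sweep D e) * s + 3 * sweep D e - tf)
    (3 * (tf - 2 * sweep D e)).
  by apply: is_derive_eq; rewrite /GRing.scale/=; ring.
rewrite (flight_density_polar _ (is_derive_cst e s 1) dt)//; last first.
  apply: filterS (near_in_itvoo sI) => x; rewrite in_itv/= => /andP[x1 x2].
  by rewrite family_curve_circle// !ltW.
congr (_%:E); rewrite expr0n add0r sqrtr_sqr !normrM (gtr0_norm e0) /angular_cost.
by rewrite (@ger0_norm _ 3)//; ring.
Qed.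

Lemma flight_density_out s : s \in `]2 / 3, 1[ ->
  flight_density (family_curve e tf D) s =
  (`|3 * (1 - e)| * radial_cost D (outward e s))%:E.
Proof.
move=> sI; have := motion_oo (outward_motion e01) sI; move=> /andP[r0 r1].
have rI : r_c D < outward e s < 1 by rewrite (le_lt_trans ce).
have dr := is_derive_motion (outward_motion e01) s.
have dt := @is_derive1_comp R (sweep D) (outward e) s _ _ (is_derive_sweep D0 rI) dr.
have dt' := is_deriveB (is_derive_cst tf s 1) dt.
apply: (flight_density_strong D0 rI _ dr dt').
  apply: filterS (near_in_itvoo sI) => x; rewrite in_itv/= => /andP[x1 x2].
  by rewrite family_curve_out// x1 ltW.
by rewrite sub0r normrN normrM normrN mulrC (ger0_norm (fS_ge0 _ _)).
Qed.

Lemma flight_time_family :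
  flight_time (family_curve e tf D) =
  (\int[mu]_(s in `]0%R, (1 / 3)%R[) (`|- (3 * (1 - e))| * radial_cost D (inward e s))%:E +
   (angular_cost e * `|tf - 2 * sweep D e|)%:E +
   \int[mu]_(s in `](2 / 3)%R, 1%R[) (`|3 * (1 - e)| * radial_cost D (outward e s))%:E)%E.
Proof.
rewrite -[LHS]/(\int[mu]_(s in `[0%R, 1%R]) flight_density (family_curve e tf D) s)%E.
set g := flight_density _.
have cc p q m rho : radial_motion p q m rho e ->
    measurable_fun `]p, q[ (fun s => (`|m| * radial_cost D (rho s))%:E).
  move=> H; apply: oo_continuous_emeasurable => s /(motion_oo H)/andP[r0 r1].
  apply: cvgM; first exact: cvg_cst.
  apply: continuous_comp; first exact: motion_continuous H s.
  by apply: radial_cost_continuous; rewrite // r1 (le_lt_trans ce).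
have m1 : measurable_fun `](0 : R), 1 / 3[ g.
  apply: eq_measurable_fun (cc _ _ _ _ (inward_motion e01)) => s.
  by rewrite inE => /flight_density_in.
have m2 : measurable_fun `](1 / 3 : R), 2 / 3[ g.
  apply: (eq_measurable_fun (cst (angular_cost e * (3 * `|tf - 2 * sweep D e|))%:E)).
    by move=> s; rewrite inE => /flight_density_circle.
  exact: measurable_cst.
have m3 : measurable_fun `](2 / 3 : R), 1[ g.
  apply: eq_measurable_fun (cc _ _ _ _ (outward_motion e01)) => s.
  by rewrite inE => /flight_density_out.
have l1 : 0 < 1 / 3 :> R by lra.
have l2 : 1 / 3 < 2 / 3 :> R by lra.
have l3 : 2 / 3 < 1 :> R by lra.
have [m12 I12] := ge0_integral_oo_split l1 l2 m1 m2 (flight_density_ge0 _).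
have [m123 I123] := ge0_integral_oo_split (lt_trans l1 l2) l3 m12 m3 (flight_density_ge0 _).
rewrite integral_itv_bndoo// I123 I12; congr (_ + _ + _)%E.
- by apply: eq_integral => s; rewrite inE => /flight_density_in.
- transitivity (\int[mu]_(s in `](1 / 3)%R, (2 / 3)%R[)
    (cst (angular_cost e * (3 * `|tf - 2 * sweep D e|))%:E) s)%E.
    by apply: eq_integral => s; rewrite inE => /flight_density_circle.
  have mI : mu `](1 / 3 : R), 2 / 3[%classic = (1 / 3)%:E.
    by rewrite lebesgue_measure_itv/= lte_fin l2 -EFinB; congr (_%:E); field.
  rewrite integral_cst//; transitivity
    ((angular_cost e * (3 * `|tf - 2 * sweep D e|))%:E * (1 / 3)%:E)%E.
    by congr (_ * _)%E; exact: mI.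
  by rewrite -EFinM; congr (_%:E); field.
- by apply: eq_integral => s; rewrite inE => /flight_density_out.
Qed.

End piece.

(** On each strong arc the smaller parameter gains less than it loses on the
    circle ([arc_cost_lt]).  This counts the angle along the circle with its
    sign, which is nonnegative for the critical parameter; for the other one the
    absolute value can only increase the flight time. *)
Lemma flight_time_lt e tf D D' : 0 < e < 1 -> 0 < D -> D < D' -> r_c D' = e ->
  2 * sweep D' e <= tf ->
  (flight_time (family_curve e tf D') < flight_time (family_curve e tf D))%E.
Proof.
move=> e01 D0 DD' cE tfe; have D'0 : 0 < D' by exact: lt_trans DD'.
have /andP[e0 e1] := e01.
have k0 : 0 <= angular_cost e by rewrite mulr_ge0 ?sqrtr_ge0 ?ltW.
have ce : r_c D <= e by rewrite -cE; exact/ltW/r_c_lt.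
have im := inward_motion e01; have om := outward_motion e01.
have a1 := arc_cost_lt im e01 D0 DD' cE; have a2 := arc_cost_lt om e01 D0 DD' cE.
have f1 := arc_cost_fin im e01 D'0 cE; have f2 := arc_cost_fin om e01 D'0 cE.
rewrite !flight_time_family ?cE//.
have ge0 E m rho p q : 0 < E -> r_c E <= e -> radial_motion p q m rho e ->
    (0 <= \int[mu]_(s in `]p, q[) (`|m| * radial_cost E (rho s))%:E)%E.
  move=> E0 Ee H; apply: integral_ge0 => s /= /(motion_oo H)/andP[r0 r1].
  by rewrite lee_fin mulr_ge0// ltW// radial_cost_gt0// r1 (le_lt_trans Ee).
have c'e : r_c D' <= e by rewrite cE.
have := ge0 _ _ _ _ _ D0 ce im; have := ge0 _ _ _ _ _ D0 ce om.
have := ge0 _ _ _ _ _ D'0 c'e im; have := ge0 _ _ _ _ _ D'0 c'e om.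
have tf0 : `|tf - 2 * sweep D' e| = tf - 2 * sweep D' e by rewrite ger0_norm// subr_ge0.
have tfn : angular_cost e * (tf - 2 * sweep D e) <= angular_cost e * `|tf - 2 * sweep D e|.
  by rewrite ler_wpM2l// ler_norm.
rewrite tf0; move: a1 a2 f1 f2 tfn.
set A := (integral _ _ _); set B := (integral _ _ _).
set C := (integral _ _ _); set E := (integral _ _ _).
case: A => [A||]//; case: C => [C||]//; case: B => [B||]//; case: E => [E||]//;
  rewrite -?EFinD ?lte_fin// ?ltry//=; lra.
Qed.
End family.

(** * Tangency *)

Section tangency.
Context {R : realType}.
Implicit Types (D u e s tf t : R).

Definition circle_tangent e t : set (R * R) :=
  range (fun x : R => polar e t + (x * - sin t, x * cos t)).

(** In the frame of the radius at angle [t], the secant has the radial component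
    [r s * cos (d s) - e] and the angular component [r s * sin (d s)].  Divided by
    [d s], they tend to 0 and to [e]. *)
Lemma tangent_line_polar (g : R -> R * R) (F : set_system R) s0 e t (r d : R -> R) :
  ProperFilter F -> 0 < e -> g s0 = polar e t ->
  (\forall s \near F, d s != 0 /\ g s = polar (r s) (t + d s)) ->
  r @ F --> e -> d @ F --> 0 -> (r s - e) / d s @[s --> F] --> 0 ->
  is_tangent_line g F s0 (circle_tangent e t).
Proof.
move=> FF e0 g0 gnear re d0 rd0.
(* sin z = gs z * z and cos z - 1 = gc z * z with gs and gc continuous at 0. *)
have /is_derive1_caratheodory[gs [gsE cgs gs0]] := is_derive_sin (0 : R).
have /is_derive1_caratheodory[gc [gcE cgc gc0]] := is_derive_cos (0 : R).
rewrite cos0 in gs0; rewrite sin0 oppr0 in gc0.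
exists (- sin t, cos t); split.
- rewrite /enorm /dotp/= mulrNN -!expr2 addrC cos2Dsin2 sqrtr1//.
- by rewrite /circle_tangent g0.
pose A s := r s * gs (d s); pose B s := (r s - e) / d s + r s * gc (d s).
have Ae : A s @[s --> F] --> e.
  rewrite -[X in _ --> X]mulr1 -gs0; apply: cvgM => //.
  by apply: cvg_comp d0 _; exact: cgs.
have rc0 : r s * gc (d s) @[s --> F] --> 0.
  rewrite -[X in _ --> X](mulr0 e) -gc0; apply: cvgM => //.
  by apply: cvg_comp d0 _; exact: cgc.
have B0 : B s @[s --> F] --> 0.
  by rewrite -[X in _ --> X]addr0; exact: cvgD rd0 rc0.
have : `|A s| / Num.sqrt (A s ^+ 2 + B s ^+ 2) @[s --> F] --> (1 : R).
  have -> : (1 : R) = `|e| / Num.sqrt (e ^+ 2 + 0 ^+ 2).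
    by rewrite expr0n addr0 sqrtr_sqr divff// normr_eq0 gt_eqF.
  have s2 : A s ^+ 2 + B s ^+ 2 @[s --> F] --> e ^+ 2 + 0 ^+ 2.
    by apply: cvgD; rewrite !expr2; apply: cvgM.
  apply: cvgM; first exact: cvg_norm.
  apply: cvgV; first by rewrite expr0n addr0 sqrtr_sqr normr_eq0 gt_eqF.
  by apply: cvg_comp s2 _; exact: sqrt_continuous.
apply: cvg_trans; apply: near_eq_cvg; apply: filterS gnear => s [ds ->].
rewrite g0 /dotp /enorm /dotp/= cosD sinD.
have := gsE (d s); have := gcE (d s); rewrite sin0 cos0 !subr0 => cE sE.
have cE' : cos (d s) = 1 + gc (d s) * d s by rewrite -cE addrC subrK.
have Ad : A s * d s = r s * sin (d s) by rewrite /A sE mulrA.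
have Bd : B s * d s = r s * cos (d s) - e.
  by rewrite /B cE'; field.
have t1 := cos2Dsin2 t.
have -> : (r s * (cos t * cos (d s) - sin t * sin (d s)) - e * cos t) * - sin t +
    (r s * (sin t * cos (d s) + cos t * sin (d s)) - e * sin t) * cos t = A s * d s.
  rewrite Ad; transitivity (r s * sin (d s) * (cos t ^+ 2 + sin t ^+ 2)); first by ring.
  by rewrite t1 mulr1.
set N := _ * _ + _ * _.
have -> : N = d s ^+ 2 * (A s ^+ 2 + B s ^+ 2).
  transitivity ((A s * d s) ^+ 2 + (B s * d s) ^+ 2); last by ring.
  rewrite Ad Bd; transitivity (((r s * sin (d s)) ^+ 2 + (r s * cos (d s) - e) ^+ 2) *
    (cos t ^+ 2 + sin t ^+ 2)); first by rewrite /N; ring.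
  by rewrite t1 mulr1.
have -> : Num.sqrt (d s ^+ 2 * (A s ^+ 2 + B s ^+ 2)) =
    `|d s| * Num.sqrt (A s ^+ 2 + B s ^+ 2) by rewrite sqrtrM ?sqr_ge0// sqrtr_sqr.
rewrite (normrM (A s) (d s)) invfM; set V := (Num.sqrt _)^-1; field.
by rewrite normr_eq0.
Qed.

Lemma circle_tangent_line e t : 0 < e ->
  is_tangent_line (circle e) t^' t (circle_tangent e t).
Proof.
move=> e0; apply: (@tangent_line_polar _ _ _ _ _ (cst e) (fun s => s - t)) => //.
- near=> s; split; last by rewrite /circle /cst addrC subrK.
  by rewrite subr_eq0; near: s; exact: nbhs_dnbhs_neq.
- exact: cvg_cst.
- rewrite -[X in _ --> X](subrr t); apply: cvgB; last exact: cvg_cst.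
  exact: nbhs_dnbhs.
- under eq_fun do rewrite subrr mul0r.
  exact: cvg_cst.
Unshelve. all: by end_near. Qed.

Lemma cvg_at_rightW (T : Type) (F : set_system T) (f : T -> R) (l : R) : Filter F ->
  f @ F --> l -> (\forall x \near F, l < f x) -> f @ F --> l^'+.
Proof.
move=> FF fl fF P; rewrite /at_right /within /= => wP.
by apply: filterS2 fF (fl _ wP) => x /= fx; apply.
Qed.

Lemma sweep_cvg D : 0 < D -> sweep D u - sweep D (r_c D) @[u --> (r_c D)^'+] --> 0.
Proof.
move=> D0; rewrite -[X in _ --> X](subrr (sweep D (r_c D))); apply: cvgB; last exact: cvg_cst.
by have [] := (continuous_within_itvP _ (r_c_lt1 D0)).1 (sweep_continuous D0).
Qed.

Lemma sweep_neq D u : 0 < D -> r_c D < u < 1 -> sweep D u - sweep D (r_c D) != 0.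
Proof.
move=> D0 /andP[cu u1]; have sub v : v \in `]r_c D, u[ -> r_c D < v < 1.
  by rewrite in_itv/= => /andP[-> /lt_trans->].
apply: (@differentiable_subr_neq0 R (sweep D) (fun v => - fS D v)) => //.
- by apply: continuous_subspaceW (sweep_continuous D0); apply: subset_itvl; rewrite bnd_simp ltW.
- by move=> v /sub; exact: is_derive_sweep.
- by move=> v /sub vI; rewrite oppr_eq0 gt_eqF// fS_gt0.
Qed.

(** L'Hopital's rule: the quotient of the derivatives is [- (fS D u)^-1], and
    [fS D] is infinite at the turning radius. *)
Lemma sweep_vertical D : 0 < D ->
  (u - r_c D) / (sweep D u - sweep D (r_c D)) @[u --> (r_c D)^'+] --> 0.
Proof.
move=> D0; have c1 := r_c_lt1 D0; have c0 := r_c_gt0 D0.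
have inI u : u \in `]r_c D, 1[ -> r_c D < u < 1 by rewrite in_itv.
have d1 u : u \in `]r_c D, 1[ -> is_derive u 1 (fun u => u - r_c D) 1.
  by move=> _; apply: is_derive_eq; rewrite subr0.
have d2 u : u \in `]r_c D, 1[ ->
    is_derive u 1 (fun u => sweep D u - sweep D (r_c D)) (- fS D u).
  move=> /inI uI; have := is_deriveB (is_derive_sweep D0 uI) (is_derive_cst (sweep D (r_c D)) u 1).
  by rewrite subr0.
apply: (lhopital_at_right c1 d1 d2).
- rewrite -[X in _ --> X](subrr (r_c D)); apply: cvgB; last exact: cvg_cst.
  exact/cvg_at_right_filter/cvg_id.
- exact: sweep_cvg.
- by move=> u /inI uI; rewrite oppr_eq0 gt_eqF// fS_gt0.
pose h u := - (u * Num.sqrt (1 - tilt D u ^+ 2) / tilt D u).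
have ch : {for r_c D, continuous h}.
  apply: cvgN; apply: cvgM; last first.
    by apply: cvgV; [rewrite tilt_r_c// oner_neq0|exact: tilt_continuous].
  apply: cvgM; first exact: cvg_id.
  apply: (@continuous_comp _ _ _ (fun u => 1 - tilt D u ^+ 2) Num.sqrt); last exact: sqrt_continuous.
  apply: cvgB; first exact: cvg_cst.
  apply: (@continuous_comp _ _ _ (tilt D) (fun x => x ^+ 2)); first exact: tilt_continuous.
  exact: exprn_continuous.
have h0 : h (r_c D) = 0 by rewrite /h tilt_r_c// expr1n subrr sqrtr0 mulr0 mul0r oppr0.
have := cvg_at_right_filter ch; rewrite h0.
apply: cvg_trans; apply: near_eq_cvg; near=> u.
have cu : r_c D < u by near: u; exact: nbhs_right_gt.
have u1 : u < 1 by near: u; exact: nbhs_right_lt.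
have u0 : 0 < u by rewrite (lt_trans c0).
rewrite /h fS_tilt ?cu ?(ltW u1)// mul1r invrN invf_div//.
Unshelve. all: by end_near. Qed.

Lemma inward_cvg e : 0 < e < 1 -> inward e s @[s --> (1 / 3)^'-] --> e^'+.
Proof.
move=> /andP[e0 e1]; apply: cvg_at_rightW.
  have {2}-> : e = inward e (1 / 3) by rewrite /inward; field.
  apply: cvg_at_left_filter; apply: cvgB; first exact: cvg_cst.
  by apply: cvgM; [exact: cvg_cst|exact: cvg_id].
near=> s; have s3 : s < 1 / 3 by near: s; exact: nbhs_left_lt.
have : 0 < (1 - e) * (1 - 3 * s) by rewrite mulr_gt0//; lra.
by rewrite /inward; lra.
Unshelve. all: by end_near. Qed.

Lemma outward_cvg e : 0 < e < 1 -> outward e s @[s --> (2 / 3)^'+] --> e^'+.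
Proof.
move=> /andP[e0 e1]; apply: cvg_at_rightW.
  have {2}-> : e = outward e (2 / 3) by rewrite /outward; field.
  apply: cvg_at_right_filter; apply: cvgD; first exact: cvg_cst.
  apply: cvgM; first exact: cvg_cst.
  by apply: cvgB; [exact: cvg_id|exact: cvg_cst].
near=> s; have s3 : 2 / 3 < s by near: s; exact: nbhs_right_gt.
have : 0 < (1 - e) * (3 * s - 2) by rewrite mulr_gt0//; lra.
by rewrite /outward; lra.
Unshelve. all: by end_near. Qed.

Lemma critical_curve_tangent D tf : 0 < D ->
  meets_circle_tangentially (r_c D) (family_curve (r_c D) tf D).
Proof.
move=> D0; have e0 := r_c_gt0 D0; have e1 := r_c_lt1 D0.
have e01 : 0 < r_c D < 1 by rewrite e0.
set e := r_c D in e0 e1 e01 *; pose S := sweep D e.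
have nearI : \forall u \near e^'+, e < u < 1.
  near=> u; apply/andP; split; near: u; [exact: nbhs_right_gt|exact: nbhs_right_lt].
have cvge : (id : R -> R) u @[u --> e^'+] --> e by exact/cvg_at_right_filter/cvg_id.
split.
- exists S; have gE : family_curve e tf D (1 / 3) = polar e S.
    rewrite family_curve_circle// ?lexx/=; last by lra.
    by congr polar; rewrite -/S; field.
  split; first by rewrite gE.
  exists (circle_tangent e S); split; last exact: circle_tangent_line.
  have ic := inward_cvg e01.
  apply: (@tangent_line_polar _ _ _ _ _ (inward e) (fun s => sweep D (inward e s) - S)) => //.
  + near=> s; split.
      have : e < inward e s < 1 by near: s; exact: ic nearI.
      exact: sweep_neq.
    rewrite (family_curve_in _ e01 D0 (lexx _)); first by rewrite addrC subrK.
    by near: s; exact: nbhs_left_lt.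
  + exact: cvg_comp ic cvge.
  + exact: cvg_comp ic (sweep_cvg D0).
  + exact: cvg_comp ic (sweep_vertical D0).
- exists (tf - S); have gE : family_curve e tf D (2 / 3) = polar e (tf - S).
    rewrite family_curve_circle// ?lexx ?andbT; last by lra.
    by congr polar; rewrite -/S; field.
  split; first by rewrite gE.
  exists (circle_tangent e (tf - S)); split; last exact: circle_tangent_line.
  have oc := outward_cvg e01.
  apply: (@tangent_line_polar _ _ _ _ _ (outward e) (fun s => - (sweep D (outward e s) - S))) => //.
  + near=> s; split.
      have : e < outward e s < 1 by near: s; exact: oc nearI.
      by rewrite oppr_eq0; exact: sweep_neq.
    rewrite (family_curve_out _ e01 D0 (lexx _)); first by congr polar; ring.
    by apply/andP; split; near: s; [exact: nbhs_right_gt|apply: nbhs_right_le; lra].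
  + exact: cvg_comp oc cvge.
  + by rewrite -oppr0; apply: cvgN; exact: cvg_comp oc (sweep_cvg D0).
  + under eq_fun do rewrite invrN mulrN.
    by rewrite -oppr0; apply: cvgN; exact: cvg_comp oc (sweep_vertical D0).
Unshelve. all: by end_near. Qed.

End tangency.

Theorem proposition7 (R : realType)
  (strong_minimal : forall D : R, 0 < D ->
     is_minimizer (A0 (strong_curve D 1)) (strong_curve D) /\
     is_minimizer (A0 (strong_curve_opp D 1)) (strong_curve_opp D))
  (epsilon theta_f : R)
  (epsilon01 : 0 < epsilon < 1) (theta_f_range : 0 < theta_f <= pi)
  (theta_f_crit : theta_crit epsilon <= theta_f / 2) :
  exists a : R -> R * R,
    [/\ is_minimizer (curve_family epsilon theta_f) a,
        forall b : R -> R * R, is_minimizer (curve_family epsilon theta_f) b ->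
          forall s : R, 0 <= s <= 1 -> b s = a s &
        meets_circle_tangentially epsilon a].
Proof.
have [D0 cE] := D_crit_spec epsilon01.
have critE : theta_crit epsilon = sweep (D_crit epsilon) epsilon.
  by rewrite /theta_crit thetaS_first// rS_half cE.
set Dc := D_crit epsilon in D0 cE critE.
have tfe : 2 * sweep Dc epsilon <= theta_f by rewrite -critE; lra.
(* D > Dc is excluded by the condition on the half angle. *)
have beat D : 0 < D -> theta_crit epsilon <= thetaS D 1 / 2 -> D != Dc ->
    (flight_time (family_curve epsilon theta_f Dc) <
     flight_time (family_curve epsilon theta_f D))%E.
  move=> D'0 + DDc; rewrite thetaS1// mulrC mulKf// critE => le.
  apply: flight_time_lt => //; rewrite lt_neqAle DDc leNgt; apply/negP => DcD.
  by have := sweep_r_c_lt D0 DcD; rewrite cE ltNge le.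
have Fc : curve_family epsilon theta_f (family_curve epsilon theta_f Dc).
  by exists Dc; split=> //; rewrite thetaS1// cE critE mulrC mulKf.
exists (family_curve epsilon theta_f Dc); split.
- split; first exact: Fc.
  move=> b [D [D'0 Dcrit ->]].
  by have [->//|/(beat _ D'0 Dcrit)/ltW] := eqVneq D Dc.
- move=> b [[D [D'0 Dcrit ->]] bmin] s _.
  have [->//|/(beat _ D'0 Dcrit)] := eqVneq D Dc.
  by rewrite ltNge bmin.
- by have := critical_curve_tangent theta_f D0; rewrite cE.
Qed.
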